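(* Let $\mu$ be a measure on $\mathbb{R}$ which is symmetric under $k\to-k$ and satisfies $\mu(\mathbb{R})<\infty$. Let $(\zeta_t)_{t\ge0}$ be the real-valued pure jump Lévy process with infinitesimal generator $$\mathcal{A}f(p)=\int_{\mathbb{R}}\left(f(p+k)-f(p)\right)\mu(dk)$$ for bounded $f:\mathbb{R}\to\mathbb{R}$. Let $U:\mathbb{R}\to\mathbb{R}$ be continuous and satisfy $$c_1\le U(p)\le c_2\left(1+|p|^M\right),\qquad p\in\mathbb{R},$$ for some $c_1\in\mathbb{R}$, $c_2>0$ and $M>0$, and assume that $\int_{\mathbb{R}}|k|^{2M}\mu(dk)<\infty$. Let $g:\mathbb{R}\to\mathbb{R}$ be continuous and bounded. Then $$u_*(t,p)=\mathbb{E}\left[g(\zeta_t)\exp\left(-\int_0^tU(\zeta_s)\,ds\right)\,\Big|\,\zeta_0=p\right]$$ is a solution of $$\begin{cases}\dfrac{\partial u_*}{\partial t}(t,p)=-U(p)u_*(t,p)+\displaystyle\int_{\mathbb{R}}\left(u_*(t,p+k)-u_*(t,p)\right)\mu(dk),&(t,p)\in(0,\infty)\times\mathbb{R},\\[2mm] u_*(0,p)=g(p),&p\in\mathbb{R}.\end{cases}$$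
   Context: $(\zeta_t)_{t\ge0}$ is taken right-continuous with left limits; conditioning on $\zeta_0=p$ means that the process is started at $p$. ''Solution'' is meant pointwise: the (two-sided) derivative $\partial u_*/\partial t(t,p)$ exists at each $(t,p)\in(0,\infty)\times\mathbb{R}$, the equation holds there, and $u_*(0,p)=g(p)$. *)

(* Defs.v *)
From HB Require Import structures.
From mathcomp Require Import all_boot all_order all_algebra.
From mathcomp Require Import all_classical all_reals all_analysis.

Set Implicit Arguments.
Unset Strict Implicit.
Unset Printing Implicit Defensive.

Import Order.TTheory GRing.Theory Num.Theory.
Import numFieldNormedType.Exports.

Local Open Scope classical_set_scope.
Local Open Scope ring_scope.

(* Processes are indexed by R; only times t >= 0 are ever constrained or used. *)

Definition cadlag (R : realType) (x : R -> R) : Prop :=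
  (forall t, 0 <= t -> x s @[s --> t^'+] --> x t) /\
  (forall t, 0 < t -> cvg (x s @[s --> t^'-])).

(* Since every B i may be setT, the product rule over the whole finite family
   contains the one over each subfamily. *)
Definition mutually_independent d (T : measurableType d) (R : realType)
    (P : probability T R) (n : nat) (X : 'I_n -> T -> R) : Prop :=
  forall B : 'I_n -> set R, (forall i, measurable (B i)) ->
    P (\bigcap_(i in [set: 'I_n]) (X i @^-1` B i)) =
    (\prod_(i < n) P (X i @^-1` B i))%E.

Definition increment (R : realType) (T : Type) (zeta : R -> T -> R) (s t : R)
  : T -> R := fun w => zeta t w - zeta s w.

(* A Levy process with arbitrary starting point, as a single path-valued
   variable zeta under a family of laws: P p is the law of the process started
   at p, i.e. the conditional law given zeta_0 = p. The law of an increment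
   depends neither on the initial time (stationarity) nor on the starting point
   (spatial homogeneity). *)
Record levy_process d (T : measurableType d) (R : realType)
    (P : R -> probability T R) (zeta : R -> T -> R) : Prop := LevyProcess {
  levy_measurable : forall t, 0 <= t -> measurable_fun setT (zeta t) ;
  levy_cadlag : forall w, cadlag (zeta ^~ w) ;
  levy_start : forall p, {ae P p, forall w, zeta 0 w = p} ;
  levy_independent : forall (p : R) (n : nat) (t : nat -> R),
    0 <= t 0%N -> nondecreasing_seq t ->
    mutually_independent (P p) (fun i : 'I_n => increment zeta (t i) (t i.+1)) ;
  levy_stationary : forall (p q s h : R) (B : set R),
    0 <= s -> 0 <= h -> measurable B ->
    P p (increment zeta s (s + h) @^-1` B) = P q (increment zeta 0 h @^-1` B)
}.

Definition transition_semigroup d (T : measurableType d) (R : realType)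
    (P : R -> probability T R) (zeta : R -> T -> R) (t : R) (f : R -> R)
    (p : R) : R :=
  fine ('E_(P p)[f \o zeta t])%E.

(* The derivative at 0+ is taken in the sup norm, on the space of bounded
   measurable functions, all of which belong to the domain of A. *)
Definition has_generator d (T : measurableType d) (R : realType)
    (P : R -> probability T R) (zeta : R -> T -> R)
    (A : (R -> R) -> (R -> R)) : Prop :=
  forall f : R -> R, measurable_fun setT f -> bounded_fun f ->
    {uniform, (fun (h : R) (p : R) =>
      h^-1 * (transition_semigroup P zeta h f p - f p)) @ 0^'+ --> A f}.

Definition jump_operator (R : realType)
    (mu : {finite_measure set (measurableTypeR R) -> \bar R})
    (f : R -> R) (p : R) : R :=
  \int[mu]_k (f (p + k) - f p).

Definition symmetric_measure (R : realType)
    (mu : {finite_measure set (measurableTypeR R) -> \bar R}) : Prop :=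
  forall B : set (measurableTypeR R), measurable B ->
    mu ((fun k : R => - k) @^-1` B) = mu B.

Definition feynman_kac d (T : measurableType d) (R : realType)
    (P : R -> probability T R) (zeta : R -> T -> R) (U g : R -> R)
    (t p : R) : R :=
  fine ('E_(P p)[fun w => (g (zeta t w) *
    expR (- \int[lebesgue_measure]_(s in `[0, t]) U (zeta s w)))%R])%E.

(* Integrability is required because \int returns a junk value otherwise. *)
Definition pointwise_solution (R : realType)
    (mu : {finite_measure set (measurableTypeR R) -> \bar R})
    (U g : R -> R) (u : R -> R -> R) : Prop :=
  (forall t p : R, 0 < t ->
     mu.-integrable setT (fun k : measurableTypeR R => (u t (p + k) - u t p)%:E) /\
     is_derive t (1 : R) (u ^~ p) (- U p * u t p + jump_operator mu (u t) p)) /\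
  (forall p : R, u 0 p = g p).

(* Main.v *)
(* Write X for the increment process started at 0, S for its semigroup and u for
   the Feynman-Kac expectation. By independence of increments, the expectation
   of a discretized functional, with the integral of U replaced by a Riemann
   sum, is a product of the one-step operators f |-> S_dt (exp (- dt U) f); by
   right-continuity of paths, u is the limit of such products (Trotter formula),
   and so is u (h + t) when the first factors act on [0, h] and the others on
   [h, h + t].

   Let w x = 1 + |x|^M for x != 0 and w 0 = 0. Iterating the generator on
   truncations of w gives E (w (X_h)) <= K h for h <= 1. Since
   |U (p + x) - U p| <= C (1 + |p|^M) w x, the first block of the product can be
   replaced by exp (- h U p) S_h up to O(h^2), whence
     u (h + t) p - u t p = (S_h (u t) p - u t p) - h U p u t p + O(h^2),
   and the right derivative follows from the generator. For the left derivative
   u t on the right-hand side has to be replaced by u (h + t): as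
   |u (h + t) q - u t q| <= C h (1 + |q|^M), the same moment bound shows that
   this changes the right-hand side by O(h^2) only. *)

Require Import Defs.
From HB Require Import structures.
From mathcomp Require Import all_boot all_order all_algebra.
From mathcomp Require Import all_classical all_reals all_analysis.
From mathcomp Require Import measurable_realfun.
From mathcomp Require Import ring lra.

Set Implicit Arguments.
Unset Strict Implicit.
Unset Printing Implicit Defensive.

Import Order.TTheory GRing.Theory Num.Theory.
Import numFieldNormedType.Exports.

Local Open Scope classical_set_scope.
Local Open Scope ring_scope.

(** * Integration of bounded functions *)

Section bounded_integration.
Context d (T : measurableType d) (R : realType).
Variable mu : {measure set T -> \bar R}.
Implicit Types (D : set T) (f : T -> R).

Lemma integrable_le_bound D f (b : R) : measurable D -> (mu D < +oo)%E ->
  measurable_fun D f -> (forall x, D x -> `|f x| <= b) ->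
  mu.-integrable D (EFin \o f).
Proof.
move=> mD muD mf fb; apply: measurable_bounded_integrable => //.
exists b; split; first exact: num_real.
by move=> c bc x Dx /=; apply: (le_trans (fb _ Dx)); exact: ltW.
Qed.

(** Dominated convergence with a constant, which is integrable because [D] has finite measure. *)
Lemma bounded_cvg_Rintegral D (f_ : nat -> T -> R) f (b : R) :
  measurable D -> (mu D < +oo)%E ->
  (forall n, measurable_fun D (f_ n)) ->
  (forall n x, D x -> `|f_ n x| <= b) ->
  (forall x, D x -> f_ ^~ x @ \oo --> f x) ->
  \int[mu]_(x in D) f_ n x @[n --> \oo] --> \int[mu]_(x in D) f x.
Proof.
move=> mD muD mf fb cf.
have mfl : measurable_fun D f by exact: measurable_fun_cvg cf.
have [| | | | |ifl _ c] := @dominated_convergence _ _ _ mu D mD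
    (fun n => EFin \o f_ n) (EFin \o f) (EFin \o cst b).
- by move=> n; exact/measurable_EFinP.
- exact/measurable_EFinP.
- apply: aeW => x Dx /=; apply: cvg_EFin; first exact: nearW.
  exact: cf.
- apply: (@integrable_le_bound _ _ `|b|) => //.
- by apply: aeW => x n Dx /=; rewrite lee_fin fb.
apply: fine_cvg; rewrite fineK//.
exact: integrable_fin_num.
Qed.

End bounded_integration.

Section probability_integration.
Context d (T : measurableType d) (R : realType) (P : probability T R).
Implicit Types (f g : T -> R).

Lemma bounded_integrable f (b : R) : measurable_fun setT f ->
  (forall x, `|f x| <= b) -> P.-integrable setT (EFin \o f).
Proof.
move=> mf fb; apply: (@integrable_le_bound _ _ _ _ _ _ b) => //.
by rewrite (le_lt_trans (@probability_le1 _ _ _ P setT _))// ltry.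
Qed.

Lemma le_norm_Rintegral f (b : R) : measurable_fun setT f ->
  (forall x, `|f x| <= b) -> `|\int[P]_x f x| <= b.
Proof.
move=> mf fb; have If := bounded_integrable mf fb.
apply: le_trans (le_normr_Rintegral _ If) _ => //.
rewrite (_ : b = \int[P]_x b); last first.
  by rewrite Rintegral_cst//= probability_setT mulr1.
apply: le_Rintegral => //.
  exact: integrable_norm.
apply: (@bounded_integrable _ `|b|) => //.
Qed.

End probability_integration.

(** * Integrals over independent variables and over parameters *)

Section independence.
Context d d' (T : measurableType d) (W : measurableType d') (R : realType).
Variables (P : probability T R) (V : T -> W) (Y : T -> R).
Hypotheses (mV : measurable_fun setT V) (mY : measurable_fun setT Y).
Hypothesis VY : forall A B, measurable A -> measurable B ->
  P (V @^-1` A `&` Y @^-1` B) = (P (V @^-1` A) * P (Y @^-1` B))%E.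

(** On rectangles the law of the pair is the product of the marginal laws, hence everywhere, and
    Fubini integrates out [Y] first. [V] has values in an arbitrary measurable space so that it can
    stand for a whole past. *)
Lemma Rintegral_indep (G : W * R -> R) (b : R) :
  measurable_fun setT G -> (forall z, `|G z| <= b) ->
  \int[P]_w G (V w, Y w) = \int[P]_w \int[P]_w' G (V w, Y w').
Proof.
move=> mG Gb.
pose V' : {mfun T >-> W} := HB.pack V (isMeasurableFun.Build _ _ _ _ V mV).
pose Y' : {mfun T >-> R} := HB.pack Y (isMeasurableFun.Build _ _ _ _ Y mY).
have mVY : measurable_fun setT (fun w => (V w, Y w)).
  exact: measurable_fun_pair.
pose VY' : {mfun T >-> (W * R)%type} :=
  HB.pack (fun w => (V w, Y w)) (isMeasurableFun.Build _ _ _ _ _ mVY).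
pose m1 : probability W R := distribution P V'.
pose m2 : probability R R := distribution P Y'.
have joint (A : set (W * R)) : measurable A ->
    (m1 \x m2)%E A = distribution P VY' A.
  apply: product_measure_unique => B C mB mC.
  by rewrite /m1 /m2 /distribution /pushforward/= -VY.
have mGE : measurable_fun setT (EFin \o G) by exact/measurable_EFinP.
have IG (f : T -> W * R) : measurable_fun setT f ->
    P.-integrable setT ((EFin \o G) \o f).
  move=> mf; apply: (@bounded_integrable _ _ _ P (G \o f) b) => [|x /=].
    exact: measurableT_comp.
  exact: Gb.
transitivity (fine (\int[distribution P VY']_z (EFin \o G) z)).
  by rewrite integral_distribution//; exact: IG.
transitivity (fine (\int[m1 \x m2]_z (EFin \o G) z)).
  congr fine; apply/esym; apply: eq_measure_integral => A mA _.
  exact: joint.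
have Ipr : (m1 \x m2)%E.-integrable setT (EFin \o G).
  apply/integrableP; split => //.
  have /integrableP[_] : (distribution P VY').-integrable setT (EFin \o G).
    apply: integrable_pushforward => //; exact: (IG _ mVY).
  congr (_ < _)%E; apply/esym; apply: eq_measure_integral => A mA _.
  exact: joint.
have mF : measurable_fun setT (fun x => \int[m2]_y (EFin \o G) (x, y))%E.
  exact: (@measurable_fubini_F _ _ _ _ _ m1 m2 _ Ipr).
have FE x : (\int[m2]_y (EFin \o G) (x, y) = (\int[P]_w G (x, Y w))%:E)%E.
  have mGx : measurable_fun setT (fun w => (x, Y w)).
    exact: measurable_fun_pair.
  rewrite -[LHS]fineK; last first.
    apply: integrable_fin_num => //.
    apply: integrable_pushforward => //; last exact: (IG _ mGx).
    exact: measurableT_comp.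
  rewrite integral_distribution//; last exact: (IG _ mGx).
  exact: measurableT_comp.
rewrite -integral12_prod_meas1// /Rintegral integral_distribution//.
  by congr fine; apply: eq_integral => w _; exact: FE.
apply/integrableP; split; first exact: measurableT_comp.
apply: (@le_lt_trans _ _ (\int[P]_w b%:E)%E); last first.
  by rewrite integral_cst//= probability_setT mule1 ltry.
apply: ge0_le_integral => //=.
- by do 2 apply: measurableT_comp => //.
- move=> w _; rewrite [fubini_F _ _ _](FE (V w)) lee_fin.
  apply: le_norm_Rintegral => //.
  by apply: measurableT_comp => //; exact: measurable_fun_pair.
Qed.
End independence.

Section parametric_integral.
Context d d' (T : measurableType d) (W : measurableType d') (R : realType).
Variable P : probability T R.

(** Tonelli gives measurability for nonnegative integrands, so [b] is added to [G] and subtracted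
    again after integration, [P] having mass one. *)
Lemma measurable_Rintegral_param (G : W * T -> R) (b : R) :
  measurable_fun setT G -> (forall z, `|G z| <= b) ->
  measurable_fun setT (fun x => \int[P]_w G (x, w)).
Proof.
move=> mG Gb.
have mGx x : measurable_fun setT (fun w => G (x, w)).
  by apply: measurableT_comp => //; exact: measurable_fun_pair.
have mGb : measurable_fun setT (fun z => (G z + b)%:E).
  by apply/measurable_EFinP; exact: measurable_funD.
have Gb0 z : (0 <= (G z + b)%:E)%E.
  by rewrite lee_fin -lerBlDr sub0r; have := Gb z; rewrite ler_norml => /andP[].
have := @measurable_fun_fubini_tonelli_F _ _ W T R P _ mGb Gb0.
move=> mF; rewrite [X in measurable_fun _ X](_ : _ =
    fun x => fine (fubini_F P (fun z => (G z + b)%:E) x) - b); last first.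
  apply/funext => x; rewrite /fubini_F -[fine _]/(\int[P]_w (G (x, w) + b)).
  rewrite RintegralD//.
  - by rewrite Rintegral_cst//= probability_setT mulr1 addrK.
  - exact: (@bounded_integrable _ _ _ _ _ b).
  - exact: (@bounded_integrable _ _ _ _ _ `|b|).
by apply: measurable_funB => //; exact: measurableT_comp.
Qed.

End parametric_integral.

(** * Independence of the past *)

Section past.
Context d (T : measurableType d) (R : realType) (P : probability T R).
Variable Y : nat -> T -> R.
Hypothesis mY : forall i, measurable_fun setT (Y i).
Hypothesis indepY : forall n, mutually_independent P (fun i : 'I_n => Y i).

(** A pi-system generating the sigma-algebra of the variables [Y i] with [i < n]. *)
Definition cylinders n : set (set T) :=
  [set C | exists2 B : nat -> set R, (forall i, measurable (B i)) &
    C = \bigcap_(i in [set: 'I_n]) (Y i @^-1` B i)].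

Let measurable_preimage i (B : set R) : measurable B ->
  measurable (Y i @^-1` B).
Proof. by move=> mB; rewrite -[X in measurable X]setTI; exact: mY. Qed.

Lemma cylinders_measurable n : cylinders n `<=` measurable.
Proof.
move=> _ [B mB ->]; apply: fin_bigcap_measurable => // i _.
exact: measurable_preimage.
Qed.

Lemma g_cylinders_measurable n : <<s cylinders n >> `<=` measurable.
Proof.
apply: smallest_sub (@cylinders_measurable n).
exact: sigma_algebra_measurable.
Qed.

Lemma preimage_cylinders n i (B : set R) : (i < n)%N -> measurable B ->
  cylinders n (Y i @^-1` B).
Proof.
move=> ni mB; exists (fun j => if j == i then B else setT).
  by move=> j; case: ifP.
apply/seteqP; split => [w Bw j _|w /(_ (Ordinal ni) I)] /=.
  by case: ifPn => // /eqP ->.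
by rewrite eqxx.
Qed.

(** As functions of [C] both sides are finite measures: [P] restricted to an event, and [P] scaled
    by the probability of that event. They agree on the pi-system of cylinders by mutual
    independence. *)
Lemma indep_past n (C : set T) (B : set R) : <<s cylinders n >> C ->
  measurable B -> P (C `&` Y n @^-1` B) = (P C * P (Y n @^-1` B))%E.
Proof.
move=> sC mB; have mD := measurable_preimage n mB.
have pD : 0 <= fine (P (Y n @^-1` B)) by exact: fine_ge0.
pose c : {nonneg R} := NngNum pD.
have cE (A : set T) : (mscale c P A = P A * P (Y n @^-1` B))%E.
  rewrite /mscale/= muleC; congr (_ * _)%E.
  by rewrite fineK// fin_num_measure.
rewrite -cE; apply: (@g_sigma_algebra_measure_unique _ R T (cylinders n)
  (@cylinders_measurable n) (fun=> setT) _ _ (mrestr P mD) (mscale c P)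
  _ _ _ C sC).
- move=> _; exists (fun=> setT) => //.
  by apply/seteqP; split.
- by rewrite bigcup_const.
- move=> _ _ [B1 mB1 ->] [B2 mB2 ->]; exists (fun i => B1 i `&` B2 i).
    by move=> i; exact: measurableI.
  apply/seteqP; split=> [w [h1 h2] i _|w h].
    by split; [exact: h1|exact: h2].
  by split => i /h [].
- move=> _ [B1 mB1 ->]; rewrite [RHS]cE /= /mrestr.
  (* Placing [B] at index [n] lets independence of [n + 1] variables handle the cylinder and the
     event on [Y n] together. *)
  pose B2 i := if i == n then B else B1 i.
  have mB2 i : measurable (B2 i) by rewrite /B2; case: ifP.
  have B2E (i : 'I_n) : B2 i = B1 i by rewrite /B2 ltn_eqF.
  have B2n : B2 n = B by rewrite /B2 eqxx.
  have := indepY (fun i : 'I_n.+1 => mB2 i).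
  rewrite big_ord_recr/= B2n.
  under eq_bigr do rewrite B2E.
  rewrite -(indepY (fun i : 'I_n => mB1 i)) => <-; congr (P _).
  apply/seteqP; split=> [w [h1 h2] i _|w h] /=.
    rewrite /B2; case: ifPn => [/eqP ->//|ni].
    have ni' : (i < n)%N by rewrite ltn_neqAle ni -ltnS ltn_ord.
    exact: (h1 (Ordinal ni')).
  split=> [i _|].
    by have := h (widen_ord (leqnSn n) i) I; rewrite /= B2E.
  by have := h ord_max I; rewrite /= B2n.
- move=> _; rewrite /= /mrestr setTI.
  by apply: (le_lt_trans (probability_le1 P mD)); rewrite ltry.
Qed.

End past.

(** * Products of one-step operators *)

Section riemann_sums.
Context (R : realType).
Implicit Types (y : R -> R) (t c : R) (s : seq R).

Definition duration s : R := \sum_(dt <- s) dt.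

(* Right endpoints, so that right-continuity of the path suffices for
   convergence to the integral. *)
Fixpoint riemann_sum y t s : R :=
  if s is dt :: s' then dt * y (t + dt) + riemann_sum y (t + dt) s' else 0.

Lemma duration_cons dt s : duration (dt :: s) = dt + duration s.
Proof. exact: big_cons. Qed.

Lemma duration_cat s1 s2 : duration (s1 ++ s2) = duration s1 + duration s2.
Proof. exact: big_cat. Qed.

Lemma duration_rcons s dt : duration (rcons s dt) = duration s + dt.
Proof. by rewrite -cats1 duration_cat /duration big_seq1. Qed.

Lemma duration_nseq n dt : duration (nseq n dt) = dt *+ n.
Proof. by rewrite /duration big_nseq iter_addr_0. Qed.

Lemma duration_uniform n t : duration (nseq n.+1 (t / n.+1%:R)) = t.
Proof. by rewrite duration_nseq -[LHS]mulr_natr divfK. Qed.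

Lemma duration_ge0 s : all (>= 0) s -> 0 <= duration s.
Proof.
by move=> /allP s0; rewrite /duration big_seq; apply: sumr_ge0 => dt /s0.
Qed.

Lemma riemann_sum_cat y t s1 s2 : riemann_sum y t (s1 ++ s2) =
  riemann_sum y t s1 + riemann_sum y (t + duration s1) s2.
Proof.
elim: s1 t => [|dt s1 IH] t /=; first by rewrite /duration big_nil addr0 add0r.
by rewrite IH duration_cons !addrA.
Qed.

Lemma riemann_sum_rcons y t s dt : riemann_sum y t (rcons s dt) =
  riemann_sum y t s + dt * y (t + (duration s + dt)).
Proof. by rewrite -cats1 riemann_sum_cat/= addr0 addrA. Qed.

Lemma riemann_sum_ge y t s c : all (>= 0) s -> (forall r, c <= y r) ->
  c * duration s <= riemann_sum y t s.
Proof.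
move=> s0 cy; elim: s t s0 => [|dt s IH] t /=.
  by rewrite /duration big_nil mulr0.
move=> /andP[dt0 s0]; rewrite duration_cons mulrDr lerD ?IH//.
by rewrite mulrC ler_wpM2l.
Qed.

(** Measurability is asked at partition times only: for the sigma-algebra of finitely many
    increments, the process is known to be measurable just at these times. *)
Lemma measurable_riemann_sum d (T : measurableType d) (F : R -> T -> R) t s :
  (forall i, (i <= size s)%N ->
     measurable_fun setT (F (t + duration (take i s)))) ->
  measurable_fun setT (fun w => riemann_sum (F ^~ w) t s).
Proof.
elim: s t => [|dt s IH] t mF /=; first exact: measurable_cst.
apply: measurable_funD.
  apply: measurable_funM; first exact: measurable_cst.
  have := mF 1%N isT; rewrite /= take0 duration_cons /duration big_nil addr0.
  exact.
apply: IH => i si; have := mF i.+1 si.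
by rewrite /= duration_cons addrA.
Qed.

End riemann_sums.

(** * Increments, their semigroup and the Kac operators *)

Section levy_process.
Context d (T : measurableType d) (R : realType).
Variables (P : R -> probability T R) (zeta : R -> T -> R).
Hypothesis zeta_levy : levy_process P zeta.

Local Notation X := (increment zeta 0).

Lemma increment0 w : X 0 w = 0.
Proof. exact: subrr. Qed.

Lemma measurable_increment s t : 0 <= s -> 0 <= t ->
  measurable_fun setT (increment zeta s t).
Proof.
by move=> s0 t0; apply: measurable_funB; apply: (levy_measurable zeta_levy).
Qed.

(** Stationarity is given on events, that is, as equality of two image measures; integration against
    them extends it to bounded functions. *)
Lemma Rintegral_stationary p q s h (F : R -> R) (b : R) : 0 <= s -> 0 <= h ->
  measurable_fun setT F -> (forall x, `|F x| <= b) ->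
  \int[P p]_w F (increment zeta s (s + h) w) = \int[P q]_w F (X h w).
Proof.
move=> s0 h0 mF Fb.
have mI : measurable_fun setT (increment zeta s (s + h)).
  by apply: measurable_increment => //; exact: addr_ge0.
have mX : measurable_fun setT (X h) by exact: measurable_increment.
pose I' : {mfun T >-> R} := HB.pack
  (increment zeta s (s + h)) (isMeasurableFun.Build _ _ _ _ _ mI).
pose X' : {mfun T >-> R} := HB.pack
  (X h) (isMeasurableFun.Build _ _ _ _ _ mX).
transitivity (fine (\int[distribution (P p) I']_x (EFin \o F) x)).
  rewrite integral_distribution//; first exact/measurable_EFinP.
  apply: (@bounded_integrable _ _ _ _ (F \o I') b) => [|x]; last exact: Fb.
  exact: measurableT_comp.
transitivity (fine (\int[distribution (P q) X']_x (EFin \o F) x)).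
  congr fine; apply: eq_measure_integral => A mA _.
  exact: (levy_stationary zeta_levy).
rewrite integral_distribution//; first exact/measurable_EFinP.
apply: (@bounded_integrable _ _ _ _ (F \o X') b) => [|x]; last exact: Fb.
exact: measurableT_comp.
Qed.

(** Written with increments under the single law [P 0], so that the starting point enters only as a
    shift. *)
Definition semigroup (t : R) (f : R -> R) (q : R) : R :=
  \int[P 0]_w f (q + X t w).

Lemma measurable_shift t (f : R -> R) q : 0 <= t -> measurable_fun setT f ->
  measurable_fun setT (fun w => f (q + X t w)).
Proof.
move=> t0 mf; apply: measurableT_comp => //; apply: measurable_funD => //.
exact: measurable_increment.
Qed.

Lemma semigroup_bound t (f : R -> R) q (b : R) :
  0 <= t -> measurable_fun setT f -> (forall x, `|f x| <= b) ->
  `|semigroup t f q| <= b.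
Proof.
by move=> t0 mf fb; apply: le_norm_Rintegral => //; exact: measurable_shift.
Qed.

Lemma measurable_semigroup t (f : R -> R) (b : R) :
  0 <= t -> measurable_fun setT f -> (forall x, `|f x| <= b) ->
  measurable_fun setT (semigroup t f).
Proof.
move=> t0 mf fb.
have := @measurable_Rintegral_param _ _ T R R (P 0)
  (fun z : R * T => f (z.1 + X t z.2)) b.
apply => //.
apply: measurableT_comp => //; apply: measurable_funD => //.
by apply: measurableT_comp => //; exact: measurable_increment.
Qed.

Section kac.
Variables (V : R -> R) (c : R).
Hypotheses (mV : measurable_fun setT V) (cV : forall x, c <= V x).

(** The weight sits inside the semigroup, hence is evaluated at the end of the time step, in
    agreement with the right endpoints of [riemann_sum]. *)
Definition kac_step (dt : R) (f : R -> R) : R -> R :=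
  semigroup dt (fun x => expR (- (dt * V x)) * f x).

(** The head of the list is the earliest time step and the outermost operator. *)
Definition kac_steps (s : seq R) (f : R -> R) : R -> R := foldr kac_step f s.

Lemma measurable_kac_weight (dt : R) (f : R -> R) : measurable_fun setT f ->
  measurable_fun setT (fun x => expR (- (dt * V x)) * f x).
Proof.
move=> mf; apply: measurable_funM => //; apply: measurableT_comp => //.
by apply: measurableT_comp => //; exact: measurable_funM.
Qed.

Lemma kac_weight_bound (dt : R) (f : R -> R) (b : R) :
  0 <= dt -> (forall x, `|f x| <= b) ->
  forall x, `|expR (- (dt * V x)) * f x| <= expR (- (c * dt)) * b.
Proof.
move=> dt0 fb x; rewrite normrM ler_pM// gtr0_norm ?expR_gt0// ler_expR lerN2.
by rewrite mulrC ler_wpM2l.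
Qed.

Lemma kac_steps_bounded s (f : R -> R) (b : R) :
  all (>= 0) s -> measurable_fun setT f -> (forall x, `|f x| <= b) ->
  measurable_fun setT (kac_steps s f) /\
  (forall x, `|kac_steps s f x| <= expR (- (c * duration s)) * b).
Proof.
move=> s0 mf fb; elim: s s0 => [|dt s IH] /= => [_|/andP[dt0 /IH[mk kb]]].
  by rewrite /duration big_nil mulr0 oppr0 expR0; split=> // x; rewrite mul1r.
have mw := measurable_kac_weight dt mk.
have wb := kac_weight_bound dt0 kb.
split; first exact: measurable_semigroup wb.
move=> x; rewrite duration_cons mulrDr opprD expRD -mulrA.
exact: semigroup_bound.
Qed.

(** Induction on the last time step: its increment is independent of the earlier ones, and
    integrating it out replaces [f] by [kac_step dt f]. *)
Lemma kac_steps_expectation s (f : R -> R) (b : R) p q : all (>= 0) s ->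
  measurable_fun setT f -> (forall x, `|f x| <= b) ->
  \int[P p]_w (expR (- riemann_sum (fun r => V (q + X r w)) 0 s) *
               f (q + X (duration s) w)) = kac_steps s f q.
Proof.
elim/last_ind: s f b => [|s dt IH] f b.
  move=> _ mf fb; rewrite /duration big_nil/=.
  under eq_Rintegral do rewrite oppr0 expR0 mul1r increment0 addr0.
  by rewrite Rintegral_cst//= probability_setT mulr1.
rewrite all_rcons => /andP[dt0 s0] mf fb.
rewrite /kac_steps foldr_rcons -/(kac_steps _ _).
have mw := measurable_kac_weight dt mf.
have wb := kac_weight_bound dt0 fb.
rewrite -(IH (kac_step dt f) _ s0 (measurable_semigroup dt0 mw wb)
  (fun x => semigroup_bound x dt0 mw wb)) {IH}.
(* Partition times; beyond the end of the list they stay constant, so that the sequence is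
   nondecreasing on all of [nat], as [levy_independent] demands. *)
pose t i := duration (take i (rcons s dt)).
pose Y i := increment zeta (t i) (t i.+1).
have all0 : all (>= 0) (rcons s dt) by rewrite all_rcons dt0.
have tS i : t i.+1 = t i + nth 0 (rcons s dt) i.
  have [si|si] := ltnP i (size (rcons s dt)).
    by rewrite /t (take_nth 0)// duration_rcons.
  by rewrite /t !take_oversize ?nth_default ?addr0// ltnW.
have nth0 i : 0 <= nth 0 (rcons s dt) i.
  have [si|si] := ltnP i (size (rcons s dt)); last by rewrite nth_default.
  by move/allP : all0; apply; exact: mem_nth.
have t00 : t 0 = 0 by rewrite /t take0 /duration big_nil.
have t_nd : nondecreasing_seq t.
  by apply/nondecreasing_seqP => i; rewrite tS lerDl.
have t_ge0 i : 0 <= t i by rewrite -t00; exact: t_nd.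
have ti i : (i <= size s)%N -> t i = duration (take i s).
  by move=> si; rewrite /t -cats1 takel_cat.
have tn : t (size s) = duration s by rewrite ti// take_size.
have mY i : measurable_fun setT (Y i) by exact: measurable_increment.
have indepY n : mutually_independent (P p) (fun i : 'I_n => Y i).
  by apply: (levy_independent zeta_levy) => //; rewrite t00.
(* [W] is [T] with the sigma-algebra of the increments before the last; the identity into [W] is the
   past to which [Rintegral_indep] is applied. *)
pose W := g_sigma_algebraType (cylinders Y (size s)).
have mYW i : (i < size s)%N -> measurable_fun setT (Y i : W -> R).
  move=> si _ B mB; rewrite setTI.
  by apply: sub_gen_smallest; exact: preimage_cylinders.
have mXW i : (i <= size s)%N -> measurable_fun setT (X (t i) : W -> R).
  elim: i => [|i IH] si.
    rewrite t00 (_ : X 0 = cst 0)//.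
    by apply/funext => w; rewrite increment0.
  rewrite (_ : X (t i.+1) = X (t i) \+ Y i); last first.
    by apply/funext => w; rewrite /= /Y /increment; ring.
  exact: (@measurable_funD _ W R setT _ _ (IH (ltnW si)) (mYW i si)).
pose h x := expR (- (dt * V x)) * f x.
(* The first coordinate carries the path up to time [t (size s)], the second the last increment. *)
pose G (z : W * R) := expR (- riemann_sum (fun r => V (q + X r z.1)) 0 s) *
  h (q + X (t (size s)) z.1 + z.2).
pose b' := expR (- (c * duration s)) * (expR (- (c * dt)) * b).
have mG : measurable_fun setT G.
  apply: measurable_funM.
    apply: (measurableT_comp (@measurable_expR R)) => //.
    apply: measurable_funN.
    apply: (measurableT_comp
      (f := fun w : W => riemann_sum (fun r => V (q + X r w)) 0 s)) => //.
    apply: measurable_riemann_sum => i si; rewrite add0r -ti//.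
    apply: measurableT_comp => //; apply: measurable_funD => //.
    exact: mXW.
  apply: measurableT_comp => //; apply: measurable_funD => //.
  apply: measurable_funD => //; apply: measurableT_comp => //.
  exact: mXW.
have Gb z : `|G z| <= b'.
  rewrite normrM; apply: ler_pM => //; last exact: wb.
  rewrite gtr0_norm ?expR_gt0// ler_expR lerN2.
  exact: riemann_sum_ge.
have mid : measurable_fun setT (id : T -> W).
  move=> _ B mB; rewrite setTI preimage_id.
  exact: (g_cylinders_measurable mY mB).
have := @Rintegral_indep _ _ _ W _ (P p) id (Y (size s)) mid (mY _) _
  G b' mG Gb.
rewrite {1}/G /= => indepE.
transitivity (\int[P p]_w G (w, Y (size s) w)).
  apply: eq_Rintegral => w _; rewrite /G/= /h.
  have XY : X (t (size s)) w + Y (size s) w = X (duration s + dt) w.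
    rewrite /Y /increment tS tn nth_rcons ltnn eqxx; ring.
  rewrite -[q + _ + _]addrA XY riemann_sum_rcons add0r opprD expRD.
  by rewrite duration_rcons mulrA.
rewrite indepE; last first.
  by move=> A B mA mB; apply: indep_past.
apply: eq_Rintegral => w _; rewrite /G/= RintegralZl//; last first.
  apply: (@bounded_integrable _ _ _ _ _ (expR (- (c * dt)) * b)) => [|x].
    by apply: measurableT_comp => //; exact: measurable_funD.
  exact: wb.
(* With the past frozen, the integral over the last increment is [kac_step dt f] at the current
   position, once stationarity has moved that increment to time zero. *)
congr (_ * _).
rewrite /kac_step /semigroup -tn.
under eq_Rintegral do rewrite /Y tS nth_rcons ltnn eqxx.
apply: (Rintegral_stationary p 0 (F := fun x => h (q + X (t (size s)) w + x))
   (b := expR (- (c * dt)) * b)) => // [|x]; last exact: wb.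
by apply: measurableT_comp => //; exact: measurable_funD.
Qed.

End kac.
End levy_process.

(** * Paths and Riemann sums *)

Section cadlag_paths.
Context (R : realType).
Implicit Types (x y : R -> R) (a t b : R) (s : seq R).

(** One-sided limits bound the path near each point, and compactness of the segment makes the bound
    uniform. *)
Lemma cadlag_bounded x t : cadlag x ->
  exists b : R, forall r : R, 0 <= r <= t -> `|x r| <= b.
Proof.
move=> [xr xl].
have near_bounded (r : R) : 0 <= r -> exists m : R,
    \forall u \near r, 0 <= u -> `|x u| <= m.
  move=> r0.
  have bounded_of_cvg (F : set_system R) (l : R) :
      Filter F -> x u @[u --> F] --> l -> \forall u \near F, `|x u| <= `|l| + 1.
    move=> FF /cvgrPdist_lt/(_ 1 ltr01); apply: filterS => u xu.
    rewrite -[x u](subrK l) (le_trans (ler_normD _ _))// addrC lerD2l.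
    by rewrite ltW// distrC.
  have rr : \forall u \near r^'+, `|x u| <= `|x r| + 1.
    by apply: bounded_of_cvg; exact: xr.
  move: rr; rewrite near_withinE => rr.
  (* A left limit is available for [r > 0] only; at [r = 0] no nonnegative point lies to the left
     and any [l] does. *)
  have [l rl] : exists l : R, \forall u \near r, u < r -> 0 <= u -> `|x u| <= l.
    move: r0; rewrite le_eqVlt => /predU1P[<-|r0].
      by exists 0; near=> u; rewrite ltNge => /negP.
    have /cvg_ex[l xrl] := xl r r0; exists (`|l| + 1).
    have : \forall u \near r^'-, `|x u| <= `|l| + 1 by exact: bounded_of_cvg.
    by rewrite near_withinE; apply: filterS => u ul ur _; exact: ul.
  exists (Num.max (`|x r| + 1) l).
  apply: filterS2 rl rr => u ul ur u0; rewrite le_max.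
  have [ltur|ltru|->] := ltgtP u r; last by rewrite lerDl ler01.
    by rewrite ul ?orbT.
  by rewrite ur.
(* The bound itself runs along the filter [+oo], so that compactness yields one [b] for the whole
   segment. *)
have /compact_near_coveringP/near_covering_withinP := @segment_compact R 0 t.
move=> /(_ R +oo (fun b r => `|x r| <= b) _)[].
- move=> r /=; rewrite in_itv/= => /andP[/near_bounded[m mP] _].
  exists ([set u | 0 <= u -> `|x u| <= m], [set b | m <= b]) => /=.
    by split => //; exact: nbhs_pinfty_ge (num_real m).
  move=> [u b] /= [um mb]; rewrite in_itv/= => /andP[/um xum _].
  exact: le_trans mb.
- move=> b [_ bP]; exists (b + 1) => r rt.
  by apply: (bP (b + 1)); rewrite ?ltrDl//= in_itv.
Unshelve. all: end_near. Qed.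

End cadlag_paths.

Section riemann_convergence.
Context (R : realType).
Implicit Types (y : R -> R) (a t b e r : R) (s : seq R) (D : set R).
Local Notation lebesgue := (@lebesgue_measure R).

Lemma lebesgue_measure_co a t : 0 <= t ->
  lebesgue_measure (`[a, a + t[ : set R) = t%:E.
Proof.
move=> t0; rewrite lebesgue_measure_itv/= lte_fin ltrDl; case: ltP => t1.
  by rewrite -EFinB addrAC subrr add0r.
by apply/eqP; rewrite eqe eq_le t0 t1.
Qed.

(** Serves to write [riemann_sum] as an integral, to which bounded convergence applies. *)
Fixpoint step_function y a s : R -> R :=
  if s is dt :: s' then
    fun r => y (a + dt) * \1_(`[a, a + dt[ : set R) r +
             step_function y (a + dt) s' r
  else fun=> 0.

Lemma measurable_step_function D y a s :
  measurable_fun D (step_function y a s).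
Proof.
elim: s a => [|dt s IH] a /=; first exact: measurable_cst.
apply: measurable_funD; last exact: IH.
apply: measurable_funM; first exact: measurable_cst.
exact: measurable_indic.
Qed.

Lemma step_function_bounded y a s :
  exists b, forall r, `|step_function y a s r| <= b.
Proof.
elim: s a => [|dt s IH] a /=; first by exists 0 => r; rewrite normr0.
have [b bP] := IH (a + dt); exists (`|y (a + dt)| + b) => r.
apply: le_trans (ler_normD _ _) _; apply: lerD => //.
rewrite normrM ler_piMr// indicE.
by case: (_ \in _); rewrite ?normr1 ?normr0.
Qed.

Lemma step_function_lt y a s r : all (>= 0) s -> r < a ->
  step_function y a s r = 0.
Proof.
elim: s a => //= dt s IH a /andP[dt0 s0] ra.
rewrite IH ?(lt_le_trans ra) ?lerDl// addr0 indicE memNset ?mulr0//=.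
by rewrite in_itv/= leNgt ra.
Qed.

(** The value is that of [y] at the right end of the cell containing [r]: strictly after [r] and
    within the mesh, as right-continuity requires. *)
Lemma step_functionE y a s r e : all (>= 0) s -> all (<= e) s ->
  a <= r < a + duration s ->
  exists2 r', r < r' <= r + e & 
    (r' <= a + duration s /\ step_function y a s r = y r').
Proof.
elim: s a => [|dt s IH] a /=.
  rewrite /duration big_nil addr0 => _ _ /andP[/le_lt_trans h /h].
  by rewrite ltxx.
move=> /andP[dt0 s0] /andP[dte se] /andP[ar]; rewrite duration_cons addrA => rd.
have [ra|ra] := ltP r (a + dt).
  exists (a + dt); first by rewrite ra lerD.
  split; first by rewrite lerDl duration_ge0.
  rewrite step_function_lt// addr0 indicE mem_set ?mulr1//=.
  by rewrite in_itv/= ar.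
have [|r' rr' [r'd ->]] := IH (a + dt) s0 se; first by rewrite ra.
exists r' => //; split => //; rewrite indicE memNset ?mulr0 ?add0r//=.
by rewrite in_itv/= [r < _]ltNge ra andbF.
Qed.

(** [D] may be larger than the union of the cells, so it stays fixed in the induction while cells
    are removed. *)
Lemma Rintegral_step_function D y a s : measurable D -> (lebesgue D < +oo)%E ->
  all (>= 0) s -> `[a, a + duration s[ `<=` D ->
  \int[lebesgue]_(r in D) step_function y a s r = riemann_sum y a s.
Proof.
move=> mD Dfin; elim: s a => [|dt s IH] a /=.
  by move=> _ _; rewrite Rintegral_cst// mul0r.
move=> /andP[dt0 s0]; rewrite duration_cons addrA => sD.
have d0 := duration_ge0 s0.
have I1 : lebesgue.-integrable D (EFin \o (\1_(`[a, a + dt[ : set R) : R -> R)).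
  apply: (@integrable_le_bound _ _ _ _ _ _ 1) => // r _.
  by rewrite indicE; case: (_ \in _); rewrite ?normr1 ?normr0.
have I2 : lebesgue.-integrable D (EFin \o step_function y (a + dt) s).
  have [b bP] := step_function_bounded y (a + dt) s.
  apply: (@integrable_le_bound _ _ _ _ _ _ b) => //.
  exact: measurable_step_function.
rewrite RintegralD//; last exact: integrableZl I1.
rewrite IH//; last first.
  apply: subset_trans sD => r /=; rewrite !in_itv/= => /andP[r1 ->].
  by rewrite andbT (le_trans _ r1)// lerDl.
congr (_ + _); rewrite RintegralZl// mulrC; congr (_ * _).
rewrite /Rintegral integral_indic// setIidl.
  by rewrite [X in fine X](lebesgue_measure_co a dt0).
apply: subset_trans sD => r /=; rewrite !in_itv/= => /andP[-> ra].
by rewrite (lt_le_trans ra)// lerDl.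
Qed.

(** The step functions converge to [y] pointwise by right-continuity, and bounded convergence
    concludes. Measurability of [y] comes along, as that of a pointwise limit. *)
Lemma riemann_sum_cvg y a t b : 0 <= t ->
  (forall r, a <= r < a + t -> y u @[u --> r^'+] --> y r) ->
  (forall r, a <= r <= a + t -> `|y r| <= b) ->
  lebesgue.-integrable `[a, a + t[ (EFin \o y) /\
  riemann_sum y a (nseq n.+1 (t / n.+1%:R)) @[n --> \oo] -->
    \int[lebesgue]_(r in `[a, a + t[) y r.
Proof.
move=> t0 yr yb.
pose s n := nseq n.+1 (t / n.+1%:R).
have dur n : duration (s n) = t.
  exact: duration_uniform.
have s0 n : all (>= 0) (s n) by rewrite all_nseq/= divr_ge0.
have sle n : all (<= (t / n.+1%:R)) (s n) by rewrite all_nseq/= lexx.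
have finI : (lebesgue (`[a, (a + t)%R[%classic : set R) < +oo)%E.
  by rewrite [X in (X < _)%E](lebesgue_measure_co a t0) ltry.
pose f n := step_function y a (s n).
have fE n r : `[a, a + t[%classic r -> exists2 r', r < r' <= r + t / n.+1%:R &
    r' <= a + t /\ f n r = y r'.
  rewrite /= in_itv/= => rat.
  have := @step_functionE y a (s n) r _ (s0 n) (sle n).
  by rewrite dur; apply.
have mf n : measurable_fun `[a, a + t[ (f n) by exact: measurable_step_function.
have fb n r : `[a, a + t[%classic r -> `|f n r| <= b.
  move=> rD; have [r' /andP[r1 _] [r2 ->]] := fE n r rD.
  move: rD; rewrite /= in_itv/= => /andP[ar _]; apply: yb.
  by rewrite r2 (le_trans ar)// ltW.
have fy r : `[a, a + t[%classic r -> f ^~ r @ \oo --> y r.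
  move=> rD; apply/cvgrPdist_lt => e e0.
  have := rD; rewrite /= in_itv/= => rD'.
  have /cvgrPdist_lt/(_ _ e0) := yr r rD'.
  rewrite near_withinE => /nbhs_ballP[/= dl dl0 dlP].
  have cv : (t / n.+1%:R) @[n --> \oo] --> (0 : R).
    rewrite -[X in _ --> X](mulr0 t); apply: cvgMr; exact: cvg_harmonic.
  have /cvgrPdist_lt/(_ _ dl0) := cv.
  apply: filter_app; near=> n; rewrite sub0r normrN => tn.
  have [r' /andP[r1 r3] [r2 ->]] := fE n r rD.
  apply: dlP => //=; rewrite /ball/= distrC ger0_norm ?subr_ge0 ?ltW//.
  rewrite ltrBlDl (le_lt_trans r3)// ltrD2l (le_lt_trans _ tn)//.
  exact: ler_norm.
have my : measurable_fun `[a, a + t[ y by exact: measurable_fun_cvg fy.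
split.
  apply: (@integrable_le_bound _ _ _ _ _ _ b) => // r /=.
  by rewrite in_itv/= => /andP[r1 r2]; apply: yb; rewrite r1 ltW.
have mI : measurable (`[a, a + t[%classic : set R) by exact: measurable_itv.
rewrite [X in X @ _](_ : _ =
    fun n => \int[lebesgue]_(r in `[a, a + t[) f n r); last first.
  apply/funext => n; rewrite (Rintegral_step_function _ mI finI)//.
  by rewrite dur.
exact: (@bounded_cvg_Rintegral _ _ R lebesgue _ f y b mI finI mf fb fy).
Unshelve. all: end_near. Qed.

End riemann_convergence.

Lemma cvg_norm_le (R : realType) (x : nat -> R) (l b : R) :
  x n @[n --> \oo] --> l -> (forall n, `|x n| <= b) -> `|l| <= b.
Proof.
move=> xl xb; have cx : `|x n| @[n --> \oo] --> `|l| by exact: cvg_norm.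
rewrite -(cvg_lim (@norm_hausdorff _ _) cx); apply: limr_le.
  by apply/cvg_ex; exists `|l|.
exact: nearW.
Qed.

(** * Riemann sums of the potential along a path *)

Section potential_along_path.
Context (R : realType).
Variable U : R -> R.
Hypothesis U_cont : continuous U.

Lemma continuous_bounded_segment (r : R) :
  exists b, forall x, `|x| <= r -> `|U x| <= b.
Proof.
have cU : {within `[- r, r], continuous U}.
  exact: continuous_subspaceT.
have [b [_ bP]] := compact_bounded
  (continuous_compact cU (@segment_compact R (- r) r)).
exists (b + 1) => x; rewrite ler_norml => xr.
by apply: (bP (b + 1)); rewrite ?ltrDl//=; exists x => //; rewrite /= in_itv.
Qed.

Variable x : R -> R.
Hypothesis cadlag_x : cadlag x.

Let lebesgue : {measure set _ -> \bar R} := @lebesgue_measure R.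
Let y r := U (x r).

Let y_right (r : R) : 0 <= r -> y u @[u --> r^'+] --> y r.
Proof.
move=> r0; apply: (@cvg_comp _ _ _ x U _ (nbhs (x r))).
  exact: cadlag_x.1.
exact: U_cont.
Qed.

Let y_bounded t : exists b, forall r : R, 0 <= r <= t -> `|y r| <= b.
Proof.
have [m mP] := cadlag_bounded t cadlag_x.
have [b bP] := continuous_bounded_segment m.
by exists b => r rt; apply/bP/mP.
Qed.

Let riemann_sum_y (a t : R) : 0 <= a -> 0 <= t ->
  lebesgue.-integrable `[a, a + t[ (EFin \o y) /\
  riemann_sum y a (nseq n.+1 (t / n.+1%:R)) @[n --> \oo] -->
    \int[lebesgue]_(r in `[a, a + t[) y r.
Proof.
move=> a0 t0; have [b yb] := y_bounded (a + t).
have [| |? ?] := @riemann_sum_cvg R y a t b t0.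
- by move=> r /andP[ar _]; apply: y_right; exact: le_trans ar.
- by move=> r /andP[ar rt]; apply: yb; rewrite rt (le_trans a0).
by split.
Qed.

Lemma riemann_sum_path t : 0 <= t ->
  riemann_sum y 0 (nseq n.+1 (t / n.+1%:R)) @[n --> \oo] -->
    \int[lebesgue]_(r in `[0, t]) y r.
Proof.
move=> t0; have [] := riemann_sum_y (lexx 0) t0.
rewrite add0r => Iy; by rewrite Rintegral_itv_bndo_bndc.
Qed.

(** The two blocks have different meshes, so convergence is applied on [[0, h[] and on [[h, h + t[]
    separately. *)
Lemma riemann_sum_path2 h t : 0 <= h -> 0 <= t ->
  riemann_sum y 0 (nseq n.+1 (h / n.+1%:R) ++ nseq n.+1 (t / n.+1%:R))
    @[n --> \oo] --> \int[lebesgue]_(r in `[0, h + t]) y r.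
Proof.
move=> h0 t0; have [_] := riemann_sum_y (lexx 0) h0; rewrite add0r => c1.
have [_ c2] := riemann_sum_y h0 t0.
have [] := riemann_sum_y (lexx 0) (addr_ge0 h0 t0); rewrite add0r => Iy _.
rewrite -Rintegral_itv_bndo_bndc//.
rewrite (@itv_bndbnd_setU _ _ _ (BLeft h)) ?bnd_simp ?lerDl//.
rewrite Rintegral_setU//; last 2 first.
  by rewrite -itv_bndbnd_setU ?bnd_simp ?lerDl.
  apply/disj_setPS => r [/=]; rewrite !in_itv/= => /andP[_ rh] /andP[].
  by rewrite leNgt rh.
apply: cvg_trans (cvgD c1 c2); apply: near_eq_cvg; near=> n.
by rewrite riemann_sum_cat duration_uniform add0r.
Unshelve. all: end_near. Qed.

End potential_along_path.

(** * Trotter formula *)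

Section feynman_kac_limit.
Context d (T : measurableType d) (R : realType).
Variables (P : R -> probability T R) (zeta : R -> T -> R).
Hypothesis zeta_levy : levy_process P zeta.
Variables (U g : R -> R) (c B : R).
Hypotheses (U_cont : continuous U) (cU : forall x, c <= U x).
Hypotheses (mg : measurable_fun setT g) (gB : forall x, `|g x| <= B).

Local Notation X := (increment zeta 0).
Local Notation u := (feynman_kac P zeta U g).

Let mU : measurable_fun setT U.
Proof. exact: continuous_measurable_fun. Qed.

Let mzeta t : 0 <= t -> measurable_fun setT (zeta t).
Proof. exact: (levy_measurable zeta_levy). Qed.

(** Under [P p], almost surely [zeta r = p + X r] for all [r] at once, which reduces the claim to
    [kac_steps_expectation]. *)
Lemma kac_steps_process s p : all (>= 0) s ->
  \int[P p]_w (expR (- riemann_sum (fun r => U (zeta r w)) 0 s) *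
               g (zeta (duration s) w)) = kac_steps P zeta U s g p.
Proof.
move=> s0; have take0s i : 0 <= duration (take i s).
  apply: duration_ge0; apply/allP => dt /mem_take; exact/allP.
rewrite -(kac_steps_expectation zeta_levy mU cU p p s0 mg gB).
have mF (F : R -> T -> R) : (forall r, 0 <= r -> measurable_fun setT (F r)) ->
    measurable_fun setT (fun w =>
      (expR (- riemann_sum (fun r => U (F r w)) 0 s) *
       g (F (duration s) w))%:E).
  move=> mF; apply/measurable_EFinP/measurable_funM.
    apply: measurableT_comp => //; apply: measurableT_comp => //.
    apply: measurable_riemann_sum => i si; apply: measurableT_comp => //.
    by apply: mF; rewrite add0r.
  apply: measurableT_comp => //; apply: mF; exact: duration_ge0.
congr fine; apply: ae_eq_integral => //.
- exact: mF.
- apply: (mF (fun r w => p + X r w)) => r r0; apply: measurable_funD => //.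
  exact: (measurable_increment zeta_levy).
have := levy_start zeta_levy p; apply: filterS => w zw _ /=.
have E r : zeta r w = p + X r w by rewrite /increment zw addrC subrK.
by rewrite E; under eq_fun do rewrite E.
Qed.

(** All partitions have duration [t], so the factor [g (zeta t w)] is fixed and the exponentials are
    bounded by [expR (- (c * t))]; bounded convergence turns pathwise convergence into convergence
    of expectations. *)
Lemma kac_steps_cvg (s : nat -> seq R) t p :
  (forall n, all (>= 0) (s n)) -> (forall n, duration (s n) = t) ->
  (forall w, riemann_sum (fun r => U (zeta r w)) 0 (s n) @[n --> \oo] -->
     \int[lebesgue_measure]_(r in `[0, t]) U (zeta r w)) ->
  kac_steps P zeta U (s n) g p @[n --> \oo] --> u t p.
Proof.
move=> s0 st sc; have t0 : 0 <= t by rewrite -(st 0%N) duration_ge0.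
have take0s n i : 0 <= duration (take i (s n)).
  by apply: duration_ge0; apply/allP => dt /mem_take; exact/allP.
rewrite /feynman_kac unlock -[fine _]/(\int[_]_w _).
under eq_fun do rewrite -kac_steps_process// st.
apply: (@bounded_cvg_Rintegral _ _ _ _ _ _ _ (expR (- (c * t)) * B)) => //.
- by rewrite (le_lt_trans (probability_le1 _ _)) ?ltry.
- move=> n; apply: measurable_funM.
    apply: measurableT_comp => //; apply: measurableT_comp => //.
    apply: measurable_riemann_sum => i si; apply: measurableT_comp => //.
    by apply: mzeta; rewrite add0r.
  by apply: measurableT_comp => //; exact: mzeta.
- move=> n w _; rewrite normrM; apply: ler_pM => //.
  rewrite gtr0_norm ?expR_gt0// ler_expR lerN2 -(st n).
  exact: riemann_sum_ge.
- move=> w _; rewrite [X in _ --> X]mulrC; apply: cvgMl.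
  apply: continuous_cvg; first exact: continuous_expR.
  exact: cvgN.
Qed.

Let s (t : R) n := nseq n.+1 (t / n.+1%:R).

Let s0 t n : 0 <= t -> all (>= 0) (s t n).
Proof. by move=> t0; rewrite all_nseq/= divr_ge0. Qed.

Let durs t n : duration (s t n) = t.
Proof. exact: duration_uniform. Qed.

Lemma feynman_kac_cvg t p : 0 <= t ->
  kac_steps P zeta U (nseq n.+1 (t / n.+1%:R)) g p @[n --> \oo] --> u t p.
Proof.
move=> t0; apply: kac_steps_cvg => [n|n|w].
- exact: s0.
- exact: durs.
- by apply: riemann_sum_path => //; exact: (levy_cadlag zeta_levy).
Qed.

(** Takes the place of the Markov property: a partition of [[0, h + t]] with a node at [h] factors
    the product of operators. *)
Lemma feynman_kac_cvg2 h t p : 0 <= h -> 0 <= t ->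
  kac_steps P zeta U (nseq n.+1 (h / n.+1%:R))
    (kac_steps P zeta U (nseq n.+1 (t / n.+1%:R)) g) p @[n --> \oo] -->
  u (h + t) p.
Proof.
move=> h0 t0.
under eq_fun do rewrite /kac_steps -foldr_cat -/(kac_steps _ _ _ _ _).
apply: (@kac_steps_cvg (fun n => s h n ++ s t n)) => [n|n|w].
- by rewrite all_cat !s0.
- by rewrite duration_cat !durs.
- by apply: riemann_sum_path2 => //; exact: (levy_cadlag zeta_levy).
Qed.

Let kac_bounded t n : 0 <= t ->
  measurable_fun setT (kac_steps P zeta U (s t n) g) /\
  forall x, `|kac_steps P zeta U (s t n) g x| <= expR (- (c * t)) * B.
Proof.
move=> t0; have := kac_steps_bounded zeta_levy mU cU (s0 n t0) mg gB.
by rewrite durs.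
Qed.

Lemma measurable_feynman_kac t : 0 <= t -> measurable_fun setT (u t).
Proof.
move=> t0; apply: (@measurable_fun_cvg _ _ _ _
  (fun n => kac_steps P zeta U (nseq n.+1 (t / n.+1%:R)) g)) => [n|p _].
  exact: (kac_bounded n t0).1.
exact: feynman_kac_cvg.
Qed.

Lemma feynman_kac_bound t p : 0 <= t -> `|u t p| <= expR (- (c * t)) * B.
Proof.
move=> t0; apply: cvg_norm_le (@feynman_kac_cvg t p t0) _ => n.
exact: (kac_bounded n t0).2.
Qed.

Lemma feynman_kac0 p : u 0 p = g p.
Proof.
have cu : kac_steps P zeta U [::] g p @[_ --> \oo] --> u 0 p.
  apply: (@kac_steps_cvg (fun=> [::])) => // [n|w].
    by rewrite /duration big_nil.
  by rewrite /= set_itv1 Rintegral_set1; exact: cvg_cst.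
have := cvg_unique _ cu (cvg_cst _).
exact.
Qed.

(** The block estimate is applied to the approximations of [u t], whose bound does not depend on
    [n], and then passes to the limit. *)
Lemma feynman_kac_step_le (e h t p : R) : 0 <= h -> 0 <= t ->
  (forall n (f : R -> R) b, measurable_fun setT f -> (forall x, `|f x| <= b) ->
    `|kac_steps P zeta U (nseq n.+1 (h / n.+1%:R)) f p -
      expR (- (h * U p)) * semigroup P zeta h f p| <= b * e) ->
  `|u (h + t) p - expR (- (h * U p)) * semigroup P zeta h (u t) p| <=
    expR (- (c * t)) * B * e.
Proof.
move=> h0 t0 step_le.
pose f n := kac_steps P zeta U (s t n) g.
have cS : semigroup P zeta h (f n) p @[n --> \oo] -->
    semigroup P zeta h (u t) p.
  apply: (@bounded_cvg_Rintegral _ _ _ _ _ _ _ (expR (- (c * t)) * B)) => //.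
  - by rewrite (le_lt_trans (probability_le1 _ _)) ?ltry.
  - move=> n; apply: (measurable_shift zeta_levy) => //.
    exact: (kac_bounded n t0).1.
  - by move=> n w _; exact: (kac_bounded n t0).2.
  - by move=> w _; exact: feynman_kac_cvg.
have cu : kac_steps P zeta U (s h n) (f n) p -
    expR (- (h * U p)) * semigroup P zeta h (f n) p @[n --> \oo] -->
    u (h + t) p - expR (- (h * U p)) * semigroup P zeta h (u t) p.
  apply: cvgB; first exact: feynman_kac_cvg2.
  by apply: cvgM => //; exact: cvg_cst.
apply: (cvg_norm_le cu) => n.
by apply: step_le; [exact: (kac_bounded n t0).1|exact: (kac_bounded n t0).2].
Qed.

End feynman_kac_limit.

(** * Moment of the increments *)

Section weights.
Context (R : realType) (M : R).
Hypothesis M_gt0 : 0 < M.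
Implicit Types (x y p : R) (n : nat).

Local Notation kappa := (2 `^ M : R).

Definition growth x : R := 1 + `|x| `^ M.

(** Vanishing at the origin is what allows an expectation of order [h] at time [h]; that of [growth]
    is at least one. *)
Definition jump_weight x : R := if x == 0 then 0 else growth x.

(* The generator is only given on bounded functions, so jump_weight has to be
   truncated; the resulting estimates do not depend on n. *)
Definition truncated_weight n x : R := Num.min (jump_weight x) n%:R.

Lemma growth_ge1 x : 1 <= growth x.
Proof. by rewrite lerDl powR_ge0. Qed.

Lemma growth_ge0 x : 0 <= growth x.
Proof. exact: le_trans (growth_ge1 x). Qed.

Lemma kappa_ge1 : 1 <= kappa.
Proof. by rewrite -{1}(powRr0 2) ler_powR ?ler1n// ltW. Qed.

(** [|x + y|] is at most twice the larger of the two norms, which works for every positive [M],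
    convex case or not. *)
Lemma powR_normD x y :
  `|x + y| `^ M <= kappa * (`|x| `^ M + `|y| `^ M).
Proof.
pose m := Num.max `|x| `|y|.
have m0 : 0 <= m by rewrite le_max normr_ge0.
have mM : m `^ M <= `|x| `^ M + `|y| `^ M.
  by rewrite /m maxEle; case: ifP => _; rewrite (lerDr, lerDl) powR_ge0.
have xym : `|x + y| <= 2 * m.
  rewrite (le_trans (ler_normD _ _))// mulr_natl mulr2n.
  by rewrite lerD// le_max lexx ?orbT.
apply: (@le_trans _ _ ((2 * m) `^ M)).
  by apply: ge0_ler_powR => //; rewrite ?ltW// nnegrE ?mulr_ge0.
by rewrite powRM// ler_wpM2l// powR_ge0.
Qed.

Lemma growthD p x : growth (p + x) <= kappa * growth p * growth x.
Proof.
apply: (@le_trans _ _ (1 + kappa * (`|p| `^ M + `|x| `^ M))).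
  by rewrite lerD2l powR_normD.
have := kappa_ge1; have := powR_ge0 `|p| M; have := powR_ge0 `|x| M.
rewrite /growth; move: (_ `^ M) (_ `^ M) (_ `^ M) => a b k a0 b0 k1.
have : 0 <= k * (a * b) by rewrite !mulr_ge0// (le_trans ler01).
lra.
Qed.

Lemma jump_weight_ge0 x : 0 <= jump_weight x.
Proof. by rewrite /jump_weight; case: ifP => // _; exact: growth_ge0. Qed.

Lemma jump_weight_le_growth x : jump_weight x <= growth x.
Proof. by rewrite /jump_weight; case: ifP => // _; exact: growth_ge0. Qed.

Lemma jump_weight0 : jump_weight 0 = 0.
Proof. by rewrite /jump_weight eqxx. Qed.

Lemma jump_weightD x y :
  jump_weight (x + y) <= kappa * (jump_weight x + jump_weight y).
Proof.
have k1 := kappa_ge1; have [->|x0] := eqVneq x 0.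
  by rewrite jump_weight0 !add0r ler_peMl ?jump_weight_ge0.
have [->|y0] := eqVneq y 0.
  by rewrite jump_weight0 !addr0 ler_peMl ?jump_weight_ge0.
rewrite {2 3}/jump_weight (negbTE x0) (negbTE y0).
apply: le_trans (jump_weight_le_growth (x + y)) _.
have := powR_normD x y; rewrite /growth.
have := powR_ge0 `|x| M; have := powR_ge0 `|y| M.
move: (`|x + y| `^ M) (`|x| `^ M) (`|y| `^ M) => a b c c0 b0 abc.
rewrite !mulrDr mulr1; move: abc; rewrite mulrDr; lra.
Qed.

Lemma truncated_weight_ge0 n x : 0 <= truncated_weight n x.
Proof. by rewrite le_min jump_weight_ge0 ler0n. Qed.

Lemma truncated_weight_norm n x : `|truncated_weight n x| <= n%:R.
Proof. by rewrite ger0_norm ?truncated_weight_ge0// ge_min lexx orbT. Qed.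

Lemma truncated_weight_le n x : truncated_weight n x <= jump_weight x.
Proof. by rewrite ge_min lexx. Qed.

Lemma truncated_weight0 n : truncated_weight n 0 = 0.
Proof. by rewrite /truncated_weight jump_weight0 min_l. Qed.

(** If one of the weights on the right is truncated, the right-hand side already exceeds [n%:R], as
    [kappa >= 1]. *)
Lemma truncated_weightD n x y : truncated_weight n (x + y) <=
  kappa * (truncated_weight n x + truncated_weight n y).
Proof.
have k1 := kappa_ge1; have := jump_weightD x y; rewrite /truncated_weight.
have := jump_weight_ge0 x; have := jump_weight_ge0 y.
move: (jump_weight (x + y)) (jump_weight x) (jump_weight y) => a b c c0 b0 abc.
have n0 := ler0n R n; move: n0; move: (n%:R) => N N0.
rewrite ge_min; case: (leP b N) => bN; case: (leP c N) => cN.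
- by rewrite abc.
- by apply/orP; right; nra.
- by apply/orP; right; nra.
- by apply/orP; right; nra.
Qed.

Lemma measurable_growth : measurable_fun setT growth.
Proof.
apply: measurable_funD => //.
apply: (measurableT_comp (@measurable_powR R M)).
exact: normr_measurable.
Qed.

Lemma measurable_jump_weight : measurable_fun setT jump_weight.
Proof.
rewrite (_ : jump_weight = growth \* \1_(~` [set 0])).
  apply: measurable_funM; first exact: measurable_growth.
  exact/measurable_indic/measurableC.
apply/funext => x; rewrite /jump_weight /= indicE.
have [->|x0] := eqVneq x 0; first by rewrite memNset ?mulr0//=; exact.
by rewrite mem_set ?mulr1//=; exact/eqP.
Qed.

Lemma measurable_truncated_weight n : measurable_fun setT (truncated_weight n).
Proof.
by apply: measurable_minr => //; exact: measurable_jump_weight.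
Qed.

Lemma truncated_weight_cvg x :
  truncated_weight n x @[n --> \oo] --> jump_weight x.
Proof.
apply: cvg_near_cst; near=> n; rewrite /truncated_weight min_l//.
by near: n; exact: nbhs_infty_ger.
Unshelve. all: end_near. Qed.

Lemma growth_factor_ge0 (L : R) (f : R -> R) :
  (forall x, `|f x| <= L * growth x) -> 0 <= L.
Proof.
move=> /(_ 0) fL; rewrite -(@pmulr_lge0 _ (growth 0)).
  by apply: le_trans fL; exact: normr_ge0.
by rewrite (lt_le_trans ltr01)// growth_ge1.
Qed.

(** The difference vanishes at [x = 0], so [growth x], which comes from the triangle inequality and
    [growthD], may be replaced by [jump_weight x]. *)
Lemma growth_diff (L : R) (f : R -> R) p x :
  (forall z, `|f z| <= L * growth z) ->
  `|f (p + x) - f p| <= 2 * L * kappa * growth p * jump_weight x.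
Proof.
move=> fL; have L0 := growth_factor_ge0 fL.
rewrite /jump_weight; have [->|x0] := eqVneq x 0.
  by rewrite addr0 subrr normr0 mulr0.
apply: le_trans (ler_normB _ _) _.
apply: (@le_trans _ _ (L * (kappa * growth p * growth x) + L * growth p)).
  apply: lerD => //; apply: le_trans (fL _) _.
  by rewrite ler_wpM2l// growthD.
have := growth_ge1 x; have := growth_ge1 p; have := kappa_ge1.
move: (growth x) (growth p) kappa => a b k k1 b1 a1.
have kba : b <= k * b * a.
  rewrite mulrAC ler_peMl ?mulr_ege1//; exact: le_trans b1.
have := ler_wpM2l L0 kba; rewrite !mulrA; lra.
Qed.

Section integrability.
Variable mu : {finite_measure set (measurableTypeR R) -> \bar R}.
Hypothesis mu_moment : (\int[mu]_k ((`|k : R| `^ (2 * M))%:E) < +oo)%E.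

(** With [a] the [M]-th power of [|k|], [1 + a <= 2 + a ^+ 2], and the right-hand side is integrable
    as [mu] is finite. *)
Lemma integrable_jump_weight : mu.-integrable setT (EFin \o jump_weight).
Proof.
apply: (@le_integrable _ (measurableTypeR R) R mu setT measurableT
  (EFin \o jump_weight)
  (EFin \o (fun k : measurableTypeR R => 2 + `|k : R| `^ (2 * M)))) => //.
- by apply/measurable_EFinP; exact: measurable_jump_weight.
- move=> k _ /=; rewrite lee_fin ger0_norm ?jump_weight_ge0//.
  rewrite ger0_norm; last first.
    by rewrite addr_ge0// powR_ge0.
  apply: le_trans (jump_weight_le_growth k) _.
  rewrite /growth mulrC powRrM powR_mulrn ?powR_ge0//.
  have := powR_ge0 `|k| M; move: (_ `^ M) => a a0; nra.
- rewrite (_ : EFin \o _ =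
    (cst 2%:E \+ (fun k : R => (`|k| `^ (2 * M))%:E))%E)//.
  apply: integrableD => //.
    exact: finite_measure_integrable_cst.
  apply/integrableP; split.
    apply/measurable_EFinP; apply: (measurableT_comp (@measurable_powR R _)).
    exact: normr_measurable.
  apply: le_lt_trans mu_moment; rewrite le_eqVlt; apply/orP; left; apply/eqP.
  by apply: eq_integral => k _; rewrite gee0_abs// lee_fin powR_ge0.
Qed.

(** The input of a Gronwall argument: a multiple of the weight plus a constant, with coefficients
    free of [n]. *)
Lemma jump_operator_truncated_weight n x :
  jump_operator mu (truncated_weight n) x <=
    kappa * fine (mu setT) * truncated_weight n x +
    kappa * \int[mu]_k jump_weight k.
Proof.
have mf : measurable_fun setT
    (fun k : R => truncated_weight n (x + k) - truncated_weight n x).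
  apply: measurable_funB => //; apply: measurableT_comp => //.
    exact: measurable_truncated_weight.
  exact: measurable_funD.
have muf : (mu setT < +oo)%E by rewrite -ge0_fin_numE// fin_num_measure.
have I1 : mu.-integrable setT (EFin \o cst (kappa * truncated_weight n x)).
  exact: finite_measure_integrable_cst.
have I2 : mu.-integrable setT (EFin \o (fun k => kappa * jump_weight k)).
  exact: (integrableZl _ _ integrable_jump_weight).
rewrite /jump_operator.
apply: (@le_trans _ _
  (\int[mu]_k (kappa * truncated_weight n x + kappa * jump_weight k))).
  apply: le_Rintegral => //.
  - apply: (@integrable_le_bound _ _ _ _ _ _ (n%:R + n%:R)) => // k _.
    by rewrite (le_trans (ler_normB _ _))// lerD// truncated_weight_norm.
  - exact: (integrableD _ I1 I2).
  - move=> k _; have := truncated_weightD n x k.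
    have := truncated_weight_le n k; have := truncated_weight_ge0 n x.
    have := kappa_ge1; nra.
rewrite RintegralD// Rintegral_cst//= RintegralZl//; last first.
  exact: integrable_jump_weight.
by rewrite mulrAC.
Qed.

End integrability.

End weights.

Section moment.
Context d (T : measurableType d) (R : realType).
Variables (P : R -> probability T R) (zeta : R -> T -> R).
Hypothesis zeta_levy : levy_process P zeta.
Variable mu : {finite_measure set (measurableTypeR R) -> \bar R}.
Hypothesis zeta_gen : has_generator P zeta (jump_operator mu).
Variable M : R.
Hypothesis M_gt0 : 0 < M.
Hypothesis mu_moment : (\int[mu]_k ((`|k : R| `^ (2 * M))%:E) < +oo)%E.

Local Notation X := (increment zeta 0).
Local Notation S := (semigroup P zeta).
Local Notation kappa := (2 `^ M : R).
Local Notation w := (jump_weight M).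
Local Notation wn := (truncated_weight M).

Lemma transition_semigroupE t (f : R -> R) (b p : R) : 0 <= t ->
  measurable_fun setT f -> (forall x, `|f x| <= b) ->
  transition_semigroup P zeta t f p = S t f p.
Proof.
move=> t0 mf fb; have mX := measurable_increment zeta_levy (lexx 0) t0.
have mfp : measurable_fun setT (fun x => f (p + x)).
  by apply: measurableT_comp => //; exact: measurable_funD.
rewrite /S -(Rintegral_stationary zeta_levy p 0 (lexx 0) t0 mfp
  (fun x => fb (p + x))).
rewrite /transition_semigroup unlock add0r; congr fine.
apply: ae_eq_integral => //.
- apply/measurable_EFinP; apply: measurableT_comp => //.
  exact: (levy_measurable zeta_levy).
- by apply/measurable_EFinP; exact: (measurable_shift zeta_levy).
have := levy_start zeta_levy p; apply: filterS => z zw _ /=.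
by rewrite /increment zw addrC subrK.
Qed.

(** [dl] is uniform in [p], so that estimates for one small step can be iterated along the
    process. *)
Lemma generator_near (f : R -> R) (b e : R) : measurable_fun setT f ->
  (forall x, `|f x| <= b) -> 0 < e ->
  exists2 dl : R, 0 < dl & forall h : R, 0 < h < dl -> forall p : R,
    `|h^-1 * (S h f p - f p) - jump_operator mu f p| < e.
Proof.
move=> mf fb e0.
have bf : bounded_fun f.
  exists b; split; first exact: num_real.
  by move=> c bc x _ /=; apply: le_trans (fb x) _; exact: ltW.
pose E := [set z : R * R | ball z.1 (PosNum e0)%:num z.2].
have entE : entourage E by exact: entourage_ball.
have := zeta_gen mf bf.
move=> /(_ [set k | forall p, `|jump_operator mu f p - k p| < e])[].
  by apply/uniform_nbhs; exists E; split => // k /= + p; exact.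
move=> dl /= dl0 dlP; exists dl => // h /andP[h0 hdl] p.
rewrite distrC -(transition_semigroupE (b := b))// ?ltW//.
by apply: dlP => //=; rewrite /ball/= sub0r normrN gtr0_norm.
Qed.

Let alpha := kappa * fine (mu setT).
(** The summand [1] absorbs the error of the difference quotient, taken with tolerance one. *)
Let beta := kappa * \int[mu]_k w k + 1.

Let alpha0 : 0 <= alpha.
Proof. by rewrite mulr_ge0 ?powR_ge0// fine_ge0. Qed.

Let beta0 : 0 <= beta.
Proof.
rewrite addr_ge0// mulr_ge0 ?powR_ge0//; apply: Rintegral_ge0 => k _.
exact: jump_weight_ge0.
Qed.

(** One step of a discrete Gronwall inequality; only [dl] depends on [n]. *)
Lemma semigroup_truncated_weight n : exists2 dl : R, 0 < dl &
  forall h : R, 0 < h < dl -> forall p,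
    S h (wn n) p <= (1 + alpha * h) * wn n p + h * beta.
Proof.
have [dl dl0 dlP] := generator_near (measurable_truncated_weight M n)
  (truncated_weight_norm M n) ltr01.
exists dl => // h hdl p; have /andP[h0 _] := hdl.
have /ltW := dlP h hdl p; rewrite ler_norml => /andP[_].
rewrite lerBlDr mulrC ler_pdivrMr// => Sh.
have := jump_operator_truncated_weight M_gt0 mu_moment n p.
rewrite -/alpha -(ler_pM2r h0) => Ah.
rewrite -(lerD2r (- wn n p)) (le_trans Sh)//.
rewrite mulrDl in Ah; rewrite /beta; lra.
Qed.

(** Kac operators with zero potential are used as iterates of the semigroup. The last term bounds
    each of the [j] summands of a geometric sum by the [j]-th power. *)
Lemma kac_steps_truncated_weight n (h : R) j p : 0 < h ->
  (forall p, S h (wn n) p <= (1 + alpha * h) * wn n p + h * beta) ->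
  kac_steps P zeta (fun=> 0) (nseq j h) (wn n) p <=
    (1 + alpha * h) ^+ j * wn n p + (1 + alpha * h) ^+ j * (j%:R * (h * beta)).
Proof.
move=> h0 Sh; elim: j p => [|j IH] p /=; first by rewrite !mul1r mul0r addr0.
set q := (1 + alpha * h) ^+ j in IH *.
have q1 : 1 <= 1 + alpha * h by rewrite lerDl mulr_ge0// ltW.
have q0 : 0 <= q by rewrite exprn_ge0// (le_trans ler01).
have m0 : measurable_fun setT (fun _ : R => 0 : R) by exact: measurable_cst.
have mw := measurable_truncated_weight M n.
have wb := truncated_weight_norm M n.
have h0' := ltW h0.
have [mk kb] := kac_steps_bounded zeta_levy m0 (fun=> lexx 0)
  (s := nseq j h) (b := n%:R) ltac:(by rewrite all_nseq h0' orbT) mw wb.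
have mk' := measurable_kac_weight m0 h mk.
have kb' := kac_weight_bound (V := fun=> 0) (fun=> lexx 0) h0' kb.
have Iw : (P 0).-integrable setT (EFin \o (fun v => wn n (p + X h v))).
  apply: (@bounded_integrable _ _ _ _ _ n%:R) => //.
  exact: (measurable_shift zeta_levy).
have Iqw : (P 0).-integrable setT (EFin \o (fun v => q * wn n (p + X h v))).
  exact: (integrableZl _ _ Iw).
have Ic : (P 0).-integrable setT (EFin \o cst (q * (j%:R * (h * beta)))).
  exact: finite_measure_integrable_cst.
rewrite {1}/kac_step /semigroup.
apply: (@le_trans _ _
  (\int[P 0]_v (q * wn n (p + X h v) + q * (j%:R * (h * beta))))).
  apply: le_Rintegral => //.
  - apply: (@bounded_integrable _ _ _ _ _ _ _ (fun v => kb' (p + X h v))).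
    exact: (measurable_shift zeta_levy p h0' mk').
  - exact: (integrableD _ Iqw Ic).
  - by move=> v _; rewrite mulr0 oppr0 expR0 mul1r; exact: IH.
rewrite RintegralD// Rintegral_cst//= probability_setT mulr1 RintegralZl//.
rewrite -/(S h (wn n) p).
apply: (@le_trans _ _
  (q * ((1 + alpha * h) * wn n p + h * beta) + q * (j%:R * (h * beta)))).
  by rewrite lerD2r ler_wpM2l.
have wp := truncated_weight_ge0 M n p.
rewrite exprSr -/q.
have -> : q * ((1 + alpha * h) * wn n p + h * beta) +
    q * (j%:R * (h * beta)) =
   q * (1 + alpha * h) * wn n p + q * (j.+1%:R * (h * beta)).
  by rewrite -natr1; ring.
by rewrite lerD2l ler_wpM2r ?ler_peMr// mulr_ge0// mulr_ge0.
Qed.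

(** The admissible step depends on [n], but step size times number of steps is always [s <= 1], so
    the Gronwall factor stays below [expR alpha]. *)
Lemma truncated_moment n (s : R) : 0 <= s <= 1 ->
  \int[P 0]_v wn n (X s v) <= expR alpha * beta * s.
Proof.
move=> /andP[s0 s1].
have := s0; rewrite le_eqVlt => /predU1P[<-|s_gt0].
  under eq_Rintegral do rewrite increment0 truncated_weight0.
  by rewrite Rintegral_cst// mul0r mulr0.
have [dl dl0 dlP] := semigroup_truncated_weight n.
pose N := Num.truncn (s / dl).
have hdl : s / N.+1%:R < dl.
  rewrite ltr_pdivrMr ?ltr0n// -ltr_pdivrMl//.
  by rewrite mulrC truncnS_gt.
have h0 : 0 < s / N.+1%:R by rewrite divr_gt0 ?ltr0n.
set h := s / N.+1%:R in hdl h0.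
have hh : 0 < h < dl by rewrite h0.
have := @kac_steps_truncated_weight n h N.+1 0 h0 (dlP h hh).
have all_h : all (>= 0) (nseq N.+1 h) by rewrite all_nseq ltW.
have m0 : measurable_fun setT (fun _ : R => 0 : R) by exact: measurable_cst.
(* With zero potential the iterated operator is the expectation at time [s]: this stands in for the
   semigroup property. *)
rewrite -(kac_steps_expectation zeta_levy m0 (fun=> lexx 0) 0 0 all_h
  (measurable_truncated_weight M n) (truncated_weight_norm M n)).
(* The weight vanishes at the starting point [0], and only the term proportional to [s] remains. *)
rewrite duration_uniform truncated_weight0 mulr0 add0r.
have Nh : N.+1%:R * h = s by rewrite mulrC divfK.
have r0 (t : R) l : riemann_sum (fun=> 0) t l = 0 :> R.
  by elim: l t => //= dt l IH t; rewrite IH mulr0 addr0.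
under eq_Rintegral do rewrite r0 oppr0 expR0 mul1r add0r.
have -> : N.+1%:R * (h * beta) = beta * s by rewrite mulrA Nh mulrC.
move=> /le_trans; apply; rewrite -[leRHS]mulrA ler_wpM2r ?mulr_ge0//.
have ah0 : 0 <= alpha * h by rewrite mulr_ge0// ltW.
apply: (@le_trans _ _ (expR (alpha * h) ^+ N.+1)).
  by rewrite lerXn2r ?nnegrE ?addr_ge0 ?expR_ge0// expR_ge1Dx.
rewrite -expRM_natl ler_expR mulrCA Nh ler_piMr//.
Qed.

(** Monotone convergence removes the truncation, the bounds being uniform in [n]. *)
Lemma increment_moment : exists2 K : R, 0 <= K & forall s, 0 <= s <= 1 ->
  (P 0).-integrable setT (EFin \o (fun v => w (X s v))) /\
  \int[P 0]_v w (X s v) <= K * s.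
Proof.
exists (expR alpha * beta); first by rewrite mulr_ge0 ?expR_ge0.
move=> s s01; have /andP[s0 _] := s01.
have mX := measurable_increment zeta_levy (lexx 0) s0.
have mw : measurable_fun setT (fun v => w (X s v)).
  by apply: measurableT_comp => //; exact: measurable_jump_weight.
have mwn n : measurable_fun setT (fun v => wn n (X s v)).
  by apply: measurableT_comp => //; exact: measurable_truncated_weight.
have wlim : (\int[P 0]_v (w (X s v))%:E <= (expR alpha * beta * s)%:E)%E.
  have : (\int[P 0]_v (wn n (X s v))%:E @[n --> \oo] -->
      \int[P 0]_v limn (fun n => (wn n (X s v))%:E))%E.
    apply: cvg_monotone_convergence => //.
    - by move=> n; exact/measurable_EFinP.
    - by move=> n v _; rewrite lee_fin truncated_weight_ge0.
    - move=> v _ n m nm; rewrite lee_fin le_min ge_min lexx/= ge_min.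
      by rewrite ler_nat nm orbT.
  have -> : (\int[P 0]_v limn (fun n => (wn n (X s v))%:E) =
             \int[P 0]_v (w (X s v))%:E)%E.
    apply: eq_integral => v _; apply: cvg_lim => //.
    by apply: cvg_EFin; [exact: nearW|exact: truncated_weight_cvg].
  move=> wcvg; rewrite -(cvg_lim _ wcvg)//; apply: lime_le.
    by apply/cvg_ex; eexists; exact: wcvg.
  apply: nearW => n; rewrite -[leLHS]fineK; last first.
    apply: (integrable_fin_num measurableT).
    apply: (@bounded_integrable _ _ _ _ (fun v => wn n (X s v)) n%:R) => // v.
    exact: truncated_weight_norm.
  by rewrite lee_fin; exact: truncated_moment.
have Iw : (P 0).-integrable setT (EFin \o (fun v => w (X s v))).
  apply/integrableP; split; first exact/measurable_EFinP.
  apply: (le_lt_trans _ (ltry (expR alpha * beta * s))).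
  apply: le_trans wlim; rewrite le_eqVlt; apply/orP; left; apply/eqP.
  by apply: eq_integral => v _; rewrite gee0_abs// lee_fin jump_weight_ge0.
split => //; rewrite -lee_fin /Rintegral fineK//.
exact: (integrable_fin_num _ Iw).
Qed.

End moment.

(** * Short-time expansion *)

Section exponential_estimates.
Context (R : realType).
Implicit Types (a b m x : R).

Lemma expRN_lipschitz m a b : - m <= a -> - m <= b ->
  `|expR (- a) - expR (- b)| <= expR m * `|a - b|.
Proof.
wlog ab : a b / a <= b => [H|] am bm.
  have [ab|/ltW ba] := leP a b; first exact: H.
  by rewrite distrC [`|a - b|]distrC; exact: H.
rewrite ger0_norm ?subr_ge0 ?ler_expR ?lerN2// ler0_norm ?subr_le0// opprB.
have -> : expR (- b) = expR (- a) * expR (- (b - a)).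
  by rewrite -expRD; congr expR; ring.
rewrite -{1}[expR (- a)]mulr1 -mulrBr ler_pM ?expR_ge0//.
- by rewrite subr_ge0 -expR0 ler_expR oppr_le0 subr_ge0.
- by rewrite ler_expR lerNl.
- by have := expR_ge1Dx (- (b - a)); lra.
Qed.

(** The inequality [1 + x <= expR x], used at [x] and at [- x], puts the remainder between [0] and
    [x * (expR x - 1)]; the Lipschitz bound does the rest. *)
Lemma expR_taylor2 m x : 0 <= m -> x <= m ->
  `|expR x - 1 - x| <= expR m * x ^+ 2.
Proof.
move=> m0 xm; have l1 := expR_ge1Dx x.
rewrite ger0_norm; last by lra.
have l2 : expR x - 1 <= x * expR x.
  have := expR_ge1Dx (- x); rewrite -(ler_pM2r (expR_gt0 x)).
  rewrite -expRD addNr expR0; lra.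
apply: (@le_trans _ _ (x * (expR x - 1))); first by lra.
have := @expRN_lipschitz m (- x) 0.
rewrite opprK oppr0 expR0 addr0 normrN lerN2 oppr_le0 => /(_ xm m0) l3.
have -> : x ^+ 2 = `|x| * `|x| by rewrite -expr2 real_normK ?num_real.
by rewrite (le_trans (ler_norm _))// normrM mulrCA ler_wpM2l.
Qed.

Lemma riemann_sum_dist (y : R -> R) t s a : all (>= 0) s ->
  `|riemann_sum y t s - duration s * a| <=
    riemann_sum (fun r => `|y r - a|) t s.
Proof.
elim: s t => [|dt s IH] t /=.
  by rewrite /duration big_nil mul0r subrr normr0.
move=> /andP[dt0 s0]; rewrite duration_cons mulrDl opprD addrACA -mulrBr.
apply: le_trans (ler_normD _ _) _; apply: lerD; last exact: IH.
by rewrite normrM ger0_norm.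
Qed.

End exponential_estimates.

Section short_time.
Context d (T : measurableType d) (R : realType).
Variables (P : R -> probability T R) (zeta : R -> T -> R).
Hypothesis zeta_levy : levy_process P zeta.
Variables (M K : R).
Hypotheses (M_gt0 : 0 < M) (K_ge0 : 0 <= K).
Local Notation X := (increment zeta 0).
Local Notation S := (semigroup P zeta).
Local Notation kappa := (2 `^ M : R).
Local Notation w := (jump_weight M).
Local Notation growth := (growth M).
Hypothesis X_moment : forall s, 0 <= s <= 1 ->
  (P 0).-integrable setT (EFin \o (fun v => w (X s v))) /\
  \int[P 0]_v w (X s v) <= K * s.

Lemma growth_increment (L : R) (f : R -> R) p h : 0 <= h <= 1 ->
  measurable_fun setT f -> (forall x, `|f x| <= L * growth x) ->
  (P 0).-integrable setT (EFin \o (fun v => `|f (p + X h v) - f p|)) /\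
  \int[P 0]_v `|f (p + X h v) - f p| <= 2 * L * kappa * growth p * (K * h).
Proof.
move=> h01 mf fL; have /andP[h0 _] := h01; have [Iw wK] := X_moment h01.
pose a := 2 * L * kappa * growth p.
have Iaw : (P 0).-integrable setT (EFin \o (fun v => a * w (X h v))).
  exact: (integrableZl _ _ Iw).
have fw v : `|f (p + X h v) - f p| <= a * w (X h v) by exact: growth_diff.
have If : (P 0).-integrable setT (EFin \o (fun v => `|f (p + X h v) - f p|)).
  apply: (le_integrable measurableT _ _ Iaw) => [|v _ /=].
    apply/measurable_EFinP; apply: measurableT_comp => //.
    apply: measurable_funB => //; exact: (measurable_shift zeta_levy).
  by rewrite lee_fin normr_id (le_trans (fw v))// ler_norm.
split => //; apply: (@le_trans _ _ (\int[P 0]_v (a * w (X h v)))).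
  by apply: le_Rintegral => // v _; exact: fw.
rewrite RintegralZl// ler_wpM2l//.
have L0 := growth_factor_ge0 fL.
by rewrite !mulr_ge0// ?powR_ge0// growth_ge0.
Qed.

Lemma semigroup_diff (L b : R) (f : R -> R) p h : 0 <= h <= 1 ->
  measurable_fun setT f -> (forall x, `|f x| <= b) ->
  (forall x, `|f x| <= L * growth x) ->
  `|S h f p - f p| <= 2 * L * kappa * growth p * (K * h).
Proof.
move=> h01 mf fb fL; have /andP[h0 _] := h01.
have [If fK] := growth_increment p h01 mf fL; apply: le_trans fK.
have I1 : (P 0).-integrable setT (EFin \o (fun v => f (p + X h v))).
  apply: (@bounded_integrable _ _ _ _ _ b) => [|v]; last exact: fb.
  exact: (measurable_shift zeta_levy).
have I2 : (P 0).-integrable setT (EFin \o cst (f p)).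
  exact: finite_measure_integrable_cst.
have -> : S h f p - f p = \int[P 0]_v (f (p + X h v) - f p).
  by rewrite RintegralB// Rintegral_cst//= probability_setT mulr1.
by apply: le_normr_Rintegral => //; exact: (integrableB _ I1 I2).
Qed.

Variables (U : R -> R) (c C0 : R).
Hypotheses (mU : measurable_fun setT U) (c_ge0 : 0 <= c).
Hypotheses (cU : forall x, - c <= U x).
Hypothesis U_growth : forall x, `|U x| <= C0 * growth x.

(** By [growth_increment] each summand has mean of the order of its time, at most [t + duration s].
    For [t = 0] the bound is thus quadratic in the duration; a general [t] serves the induction. *)
Lemma riemann_sum_increment p t s : all (>= 0) s -> 0 <= t ->
  t + duration s <= 1 ->
  let y v r := `|U (p + X r v) - U p| in
  (P 0).-integrable setT (EFin \o (fun v => riemann_sum (y v) t s)) /\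
  \int[P 0]_v riemann_sum (y v) t s <=
    duration s * (2 * C0 * kappa * growth p * (K * (t + duration s))).
Proof.
move=> + + + y; elim: s t => [|dt s IH] t /=.
  move=> _ _ _; split; first exact: finite_measure_integrable_cst.
  by rewrite Rintegral_cst// /duration big_nil !mul0r.
rewrite duration_cons => /andP[dt0 s0] t0 ts1; have ds0 := duration_ge0 s0.
have tdt0 : 0 <= t + dt by exact: addr_ge0.
have tdt1 : t + dt <= 1 by rewrite (le_trans _ ts1)// lerD2l lerDl.
have [|I1 le1] := @growth_increment C0 U p (t + dt) _ mU U_growth.
  by rewrite tdt0.
have [//||I2 le2] := IH (t + dt) s0; first by rewrite -addrA.
have I1' : (P 0).-integrable setT (EFin \o (fun v => dt * y v (t + dt))).
  exact: (integrableZl _ _ I1).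
split; first exact: (integrableD _ I1' I2).
rewrite RintegralD// RintegralZl// mulrDl; apply: lerD.
  rewrite ler_wpM2l// (le_trans le1)//.
  rewrite ler_wpM2l//; last by rewrite ler_wpM2l// lerD2l lerDl.
  have C0_ge0 := growth_factor_ge0 U_growth.
  by rewrite !mulr_ge0// ?powR_ge0// growth_ge0.
by rewrite addrA.
Qed.

(** Both terms are expectations of [f (p + X h v)] with different weights, and these differ by at
    most [expR c] times the Riemann sum of [|U (p + X r v) - U p|]. The bound is free of [n] and
    survives the Trotter limit. *)
Lemma kac_steps_short (f : R -> R) (b : R) p h n : 0 <= h <= 1 ->
  measurable_fun setT f -> (forall x, `|f x| <= b) ->
  `|kac_steps P zeta U (nseq n.+1 (h / n.+1%:R)) f p -
    expR (- (h * U p)) * S h f p| <=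
  b * (expR c * (h * (2 * C0 * kappa * growth p * (K * h)))).
Proof.
move=> h01 mf fb; have /andP[h0 h1] := h01.
set s := nseq _ _; have s0 : all (>= 0) s by rewrite all_nseq divr_ge0.
have ds : duration s = h by exact: duration_uniform.
have b0 : 0 <= b by rewrite (le_trans _ (fb 0)).
rewrite -(kac_steps_expectation zeta_levy mU cU 0 p s0 mf fb) ds.
(* For times at most one both exponents stay above [- c], where the exponential has Lipschitz
   constant [expR c]. *)
have ch (a : R) : 0 <= a -> a <= 1 -> - c <= - c * a.
  by move=> a0 a1; rewrite mulNr lerN2 ler_piMr.
pose y v r := U (p + X r v).
have mr : measurable_fun setT (fun v => riemann_sum (y v) 0 s).
  apply: measurable_riemann_sum => i si.
  apply: (measurable_shift zeta_levy) => //.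
  by rewrite add0r duration_ge0//; apply/allP => dt /mem_take; exact/allP.
have me : measurable_fun setT (fun v => expR (- riemann_sum (y v) 0 s)).
  by apply: measurableT_comp => //; exact: measurableT_comp.
have mfX := measurable_shift zeta_levy p h0 mf.
have ry v : - c * h <= riemann_sum (y v) 0 s.
  by rewrite -{1}ds; apply: riemann_sum_ge => // r; exact: cU.
have I1 : (P 0).-integrable setT (EFin \o (fun v =>
    expR (- riemann_sum (y v) 0 s) * f (p + X h v))).
  apply: (@bounded_integrable _ _ _ _ _ (expR (- (- c * h)) * b)).
    exact: measurable_funM.
  move=> v; rewrite normrM ler_pM// gtr0_norm ?expR_gt0// ler_expR lerN2.
  exact: ry.
have If : (P 0).-integrable setT (EFin \o (fun v => f (p + X h v))).
  by apply: (@bounded_integrable _ _ _ _ _ b) => // v; exact: fb.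
have I2 : (P 0).-integrable setT (EFin \o (fun v =>
    expR (- (h * U p)) * f (p + X h v))).
  exact: (integrableZl _ _ If).
rewrite -RintegralZl// -RintegralB//.
have [||I3 le3] := @riemann_sum_increment p 0 s s0; rewrite ?ds ?add0r//.
rewrite ds add0r in le3.
have I4 : (P 0).-integrable setT (EFin \o (fun v => b * expR c *
    riemann_sum (fun r => `|U (p + X r v) - U p|) 0 s)).
  exact: (integrableZl _ _ I3).
apply: le_trans (le_normr_Rintegral _ (integrableB _ I1 I2)) _ => //.
apply: (@le_trans _ _ (\int[P 0]_v (b * expR c *
    riemann_sum (fun r => `|U (p + X r v) - U p|) 0 s))).
  apply: le_Rintegral => //.
    exact: (integrable_norm (integrableB _ I1 I2)).
  move=> v _; rewrite -mulrBl normrM mulrC -mulrA ler_pM//.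
  apply: (@le_trans _ _ (expR c * `|riemann_sum (y v) 0 s - h * U p|)).
    apply: expRN_lipschitz; first by rewrite (le_trans _ (ry v))// ch.
    rewrite (le_trans (ch h h0 h1))// mulrC ler_wpM2l//.
  rewrite ler_wpM2l ?expR_ge0// -{1}ds; exact: riemann_sum_dist.
by rewrite RintegralZl// -mulrA ler_wpM2l// ler_wpM2l ?expR_ge0.
Qed.

End short_time.

(* Passes from the expansion at the earlier time, of value y, to the one at the
   later time, of value x. *)
Lemma norm_rebase (R : realDomainType) (x y z z' a e1 e2 e3 : R) :
  `|x - y - (z - y) + a * y| <= e1 -> `|(z' - z) - (x - y)| <= e2 ->
  `|a * (x - y)| <= e3 -> `|x - y - (z' - x) + a * x| <= e1 + e2 + e3.
Proof.
move=> h1 h2 h3; have -> : x - y - (z' - x) + a * x =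
  (x - y - (z - y) + a * y) - ((z' - z) - (x - y)) + a * (x - y) by ring.
apply: le_trans (ler_normD _ _) _; apply: lerD => //.
by apply: le_trans (ler_normB _ _) _; exact: lerD.
Qed.

(** * Second-order error bounds for the Feynman-Kac expectation *)

Section expansion.
Context d (T : measurableType d) (R : realType).
Variables (P : R -> probability T R) (zeta : R -> T -> R).
Hypothesis zeta_levy : levy_process P zeta.
Variables (M K : R).
Hypotheses (M_gt0 : 0 < M) (K_ge0 : 0 <= K).
Local Notation X := (increment zeta 0).
Local Notation S := (semigroup P zeta).
Local Notation kappa := (2 `^ M : R).
Local Notation growth := (growth M).
Hypothesis X_moment : forall s, 0 <= s <= 1 ->
  (P 0).-integrable setT (EFin \o (fun v => jump_weight M (X s v))) /\
  \int[P 0]_v jump_weight M (X s v) <= K * s.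
Variables (U g : R -> R) (c C0 B : R).
Hypotheses (U_cont : continuous U) (c_ge0 : 0 <= c).
Hypotheses (cU : forall x, - c <= U x).
Hypothesis U_growth : forall x, `|U x| <= C0 * growth x.
Hypotheses (mg : measurable_fun setT g) (gB : forall x, `|g x| <= B).
Local Notation u := (feynman_kac P zeta U g).

Let mU : measurable_fun setT U.
Proof. exact: continuous_measurable_fun. Qed.

Let B_ge0 : 0 <= B.
Proof. exact: le_trans (gB 0). Qed.

Let C0_ge0 : 0 <= C0.
Proof. exact: growth_factor_ge0 U_growth. Qed.

Let growth_ge0 p : 0 <= growth p.
Proof. exact: growth_ge0. Qed.

Variable tmax : R.

(** A bound of [u] on [[0, tmax]]; the later constants depend on time through it only. *)
Let b := expR (c * tmax) * B.

Let b_ge0 : 0 <= b.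
Proof. by rewrite mulr_ge0 ?expR_ge0. Qed.

Let mu_t t : 0 <= t -> measurable_fun setT (u t).
Proof. exact: (measurable_feynman_kac zeta_levy U_cont cU mg gB). Qed.

Let u_bound t x : 0 <= t <= tmax -> `|u t x| <= b.
Proof.
move=> /andP[t0 tm].
apply: le_trans (feynman_kac_bound zeta_levy U_cont cU mg gB x t0) _.
by rewrite mulNr opprK ler_wpM2r// ler_expR ler_wpM2l.
Qed.

(** [D] is the constant of [kac_steps_short], [J] that of [semigroup_diff], stripped of the factors
    that vary. *)
Let D := 2 * C0 * kappa * K.
Let J := 2 * kappa * K.

Let D_ge0 : 0 <= D.
Proof. by rewrite !mulr_ge0 ?powR_ge0. Qed.

Let J_ge0 : 0 <= J.
Proof. by rewrite !mulr_ge0 ?powR_ge0. Qed.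

Let u_step h t p : 0 <= h <= 1 -> 0 <= t <= tmax ->
  `|u (h + t) p - expR (- (h * U p)) * S h (u t) p| <=
    b * (expR c * D * growth p) * h ^+ 2.
Proof.
move=> h01 /andP[t0 tm]; have /andP[h0 _] := h01.
have := @feynman_kac_step_le _ _ _ _ _ zeta_levy U g (- c) B U_cont cU mg gB
  (expR c * (h * (2 * C0 * kappa * growth p * (K * h)))) h t p h0 t0.
move=> /(_ _)/le_trans; apply.
  move=> n f bf mf fb.
  exact: (kac_steps_short zeta_levy M_gt0 K_ge0 X_moment mU c_ge0 cU U_growth).
have -> : expR c * (h * (2 * C0 * kappa * growth p * (K * h))) =
  expR c * D * growth p * h ^+ 2 by rewrite /D; ring.
rewrite mulrA ler_wpM2r ?sqr_ge0// ler_wpM2r//.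
  by rewrite !mulr_ge0 ?expR_ge0.
by rewrite mulNr opprK /b ler_wpM2r// ler_expR ler_wpM2l.
Qed.

Let S_diff (L bf : R) (f : R -> R) p h : 0 <= h <= 1 ->
  measurable_fun setT f -> (forall x, `|f x| <= bf) ->
  (forall x, `|f x| <= L * growth x) ->
  `|S h f p - f p| <= L * J * growth p * h.
Proof.
move=> h01 mf fb fL.
apply: le_trans (semigroup_diff zeta_levy M_gt0 X_moment p h01 mf fb fL) _.
by rewrite le_eqVlt; apply/orP; left; apply/eqP; rewrite /J; ring.
Qed.

Let bounded_growth x (y : R) : `|y| <= b -> `|y| <= b * growth x.
Proof. by move=> /le_trans; apply; rewrite ler_peMr// growth_ge1. Qed.

Let hU h p : 0 <= h <= 1 -> - (h * U p) <= c.
Proof.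
move=> /andP[h0 h1]; rewrite lerNl; apply: (@le_trans _ _ (h * - c)).
  by rewrite mulrN lerN2 ler_piMl.
by rewrite ler_wpM2l.
Qed.

Let hU_norm h p : 0 <= h <= 1 -> `|h * U p| <= C0 * growth p * h.
Proof. by move=> /andP[h0 _]; rewrite normrM ger0_norm// mulrC ler_wpM2r. Qed.

Let expR_hU1 h p : 0 <= h <= 1 ->
  `|expR (- (h * U p)) - 1| <= expR c * C0 * growth p * h.
Proof.
move=> h01; rewrite -[1 in X in X <= _]expR0 -[0 in X in X <= _]oppr0.
apply: le_trans (expRN_lipschitz (m := c) _ _) _.
- by rewrite lerNl hU.
- by rewrite oppr_le0.
by rewrite subr0 -!mulrA ler_wpM2l ?expR_ge0// mulrA hU_norm.
Qed.

Let expR_hU2 h p : 0 <= h <= 1 ->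
  `|expR (- (h * U p)) - 1 + h * U p| <= expR c * (C0 * growth p) ^+ 2 * h ^+ 2.
Proof.
move=> h01; have := expR_taylor2 c_ge0 (hU p h01).
rewrite opprK => /le_trans; apply.
rewrite -mulrA ler_wpM2l ?expR_ge0// sqrrN -exprMn -real_normK ?num_real//.
by rewrite lerXn2r ?nnegrE ?hU_norm// !mulr_ge0//; case/andP : h01.
Qed.

Let S_bound h t p : 0 <= h -> 0 <= t <= tmax -> `|S h (u t) p| <= b.
Proof.
move=> h0 t01; have /andP[t0 _] := t01.
apply: (semigroup_bound zeta_levy) => //; first exact: mu_t.
by move=> x; exact: u_bound.
Qed.

Let C2 := b * (expR c * D + expR c * C0 + J).

(** Puts a factor [h] into the growth bound of [u (h + t) - u t], so that [S_diff] applied to this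
    difference yields [h ^+ 2]. *)
Let u_lipschitz h t p : 0 <= h <= 1 -> 0 <= t <= tmax ->
  `|u (h + t) p - u t p| <= C2 * h * growth p.
Proof.
move=> h01 t01; have /andP[h0 h1] := h01; have /andP[t0 _] := t01.
have s1 := u_step p h01 t01.
have s2 := expR_hU1 p h01.
have s3 : `|S h (u t) p - u t p| <= b * J * growth p * h.
  apply: (@S_diff b b) => // [|x|x]; first exact: mu_t.
    exact: u_bound.
  by apply: bounded_growth; exact: u_bound.
have split_diff (x y e z : R) :
  x - y = (x - e * z) + ((e - 1) * z + (z - y)) by ring.
rewrite (split_diff _ _ (expR (- (h * U p))) (S h (u t) p)).
apply: le_trans (ler_normD _ _) _.
have -> : C2 * h * growth p = b * (expR c * D * growth p) * h +
  (expR c * C0 * growth p * h * b + b * J * growth p * h) by rewrite /C2; ring.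
apply: lerD.
  apply: (le_trans s1); rewrite ler_wpM2l//; last by rewrite expr2 ler_piMl.
  by rewrite !mulr_ge0 ?expR_ge0.
apply: le_trans (ler_normD _ _) _; apply: lerD => //.
by rewrite normrM ler_pM// S_bound.
Qed.

(** In order: replacement of the first block, product of the first-order changes of exponential and
    semigroup, second-order remainder of the exponential. *)
Let C3 p := b * (expR c * D * growth p) +
  expR c * C0 * growth p * (b * J * growth p) +
  expR c * (C0 * growth p) ^+ 2 * b.

(** The added terms pay for moving to the later time, first in the semigroup difference, then in the
    potential term. *)
Let C4 p := C3 p + C2 * J * growth p + C0 * growth p * (C2 * growth p).

(* The second estimate expands at the later time h + t; it is the one that gives
   the left derivative. *)
Lemma feynman_kac_expansion p : exists2 C, 0 <= C &
  forall h t, 0 <= h <= 1 -> 0 <= t -> h + t <= tmax ->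
  `|u (h + t) p - u t p - (S h (u t) p - u t p) + h * U p * u t p| <=
     C * h ^+ 2 /\
  `|u (h + t) p - u t p - (S h (u (h + t)) p - u (h + t) p) +
     h * U p * u (h + t) p| <= C * h ^+ 2.
Proof.
have C2_ge0 : 0 <= C2 by rewrite mulr_ge0// !addr_ge0// !mulr_ge0 ?expR_ge0.
have C3_ge0 : 0 <= C3 p.
  by rewrite !addr_ge0// ?mulr_ge0// ?mulr_ge0// ?mulr_ge0 ?expR_ge0 ?sqr_ge0.
have C34 : C3 p <= C4 p.
  rewrite /C4 -addrA lerDl.
  exact: addr_ge0 (mulr_ge0 (mulr_ge0 C2_ge0 J_ge0) (growth_ge0 p))
    (mulr_ge0 (mulr_ge0 C0_ge0 (growth_ge0 p))
              (mulr_ge0 C2_ge0 (growth_ge0 p))).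
exists (C4 p); first exact: le_trans C34.
move=> h t h01 t0 htm; have /andP[h0 h1] := h01.
have tm : t <= tmax by rewrite (le_trans _ htm)// lerDr.
have t01 : 0 <= t <= tmax by rewrite t0.
have ht0 : 0 <= h + t by exact: addr_ge0.
have ht01 : 0 <= h + t <= tmax by rewrite ht0.
have s3 : `|S h (u t) p - u t p| <= b * J * growth p * h.
  apply: (@S_diff b b) => // [|x|x]; first exact: mu_t.
    exact: u_bound.
  by apply: bounded_growth; exact: u_bound.
have first_order :
    `|u (h + t) p - u t p - (S h (u t) p - u t p) + h * U p * u t p| <=
     C3 p * h ^+ 2.
  have split_diff (x y e z a : R) : x - y - (z - y) + a * y =
    (x - e * z) + (e - 1) * (z - y) + (e - 1 + a) * y by ring.
  rewrite (split_diff _ _ (expR (- (h * U p)))).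
  rewrite [leRHS]mulrDl [X in _ <= X + _]mulrDl.
  apply: le_trans (ler_normD _ _) _; apply: lerD; last first.
    rewrite normrM mulrAC ler_pM//; first exact: expR_hU2.
    exact: u_bound.
  apply: le_trans (ler_normD _ _) _; apply: lerD; first exact: u_step.
  have -> : expR c * C0 * growth p * (b * J * growth p) * h ^+ 2 =
    (expR c * C0 * growth p * h) * (b * J * growth p * h) by ring.
  by rewrite normrM ler_pM// expR_hU1.
split; first by rewrite (le_trans first_order)// ler_wpM2r// sqr_ge0.
(* Moving to the later time changes the semigroup difference by [S h v p - v p], which is of order
   [h ^+ 2] since [v] is itself of order [h]. *)
pose v x := u (h + t) x - u t x.
have mv : measurable_fun setT v by apply: measurable_funB; exact: mu_t.
have vb x : `|v x| <= b + b.
  by rewrite (le_trans (ler_normB _ _))// lerD// u_bound.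
have vC x : `|v x| <= C2 * h * growth x by exact: u_lipschitz.
have sv := @S_diff _ _ v p h h01 mv vb vC.
have Iu s : 0 <= s <= tmax ->
    (P 0).-integrable setT (EFin \o (fun z => u s (p + X h z))).
  move=> s01; have /andP[s0 _] := s01.
  apply: (@bounded_integrable _ _ _ _ _ b) => [|z]; last exact: u_bound.
  by apply: (measurable_shift zeta_levy) => //; exact: mu_t.
have SB : S h v p = S h (u (h + t)) p - S h (u t) p.
  by rewrite /semigroup RintegralB//; exact: Iu.
have C4E : C4 p * h ^+ 2 = C3 p * h ^+ 2 + C2 * h * J * growth p * h +
    (C0 * growth p * h) * (C2 * h * growth p) by rewrite /C4; ring.
rewrite C4E; apply: (norm_rebase first_order); first by rewrite SB in sv.
by rewrite normrM ler_pM// ?hU_norm//; exact: vC.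
Qed.

End expansion.

(** * From the expansion to the two-sided derivative *)

Lemma quotient_estimate (R : realFieldType) (k delta sigma y C : R) : 0 < k ->
  `|delta - sigma + k * y| <= C * k ^+ 2 ->
  `|k^-1 * delta - k^-1 * sigma + y| <= C * k.
Proof.
move=> k0 le_k2.
have -> : k^-1 * delta - k^-1 * sigma + y = k^-1 * (delta - sigma + k * y).
  by field; rewrite gt_eqF.
rewrite normrM gtr0_norm ?invr_gt0// ler_pdivrMl// (le_trans le_k2)//.
by rewrite expr2 mulrCA.
Qed.

(** One [sigma] and one [y] serve both sides because the backward expansion also refers to time [t];
    [sigma h] stands for the semigroup difference. *)
Lemma is_derive_expansion (R : realType) (v sigma : R -> R) (t y l C : R) :
  0 < t -> 0 <= C ->
  (forall h, 0 < h <= 1 ->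
    `|v (h + t) - v t - sigma h + h * y| <= C * h ^+ 2) ->
  (forall h, 0 < h <= 1 -> h <= t ->
    `|v t - v (t - h) - sigma h + h * y| <= C * h ^+ 2) ->
  (forall e, 0 < e -> exists2 dl, 0 < dl &
    forall h, 0 < h < dl -> `|h^-1 * sigma h - l| < e) ->
  is_derive t (1 : R) v (- y + l).
Proof.
move=> t0 C0 right_exp left_exp sigma_l.
suff cvgl :
    h^-1 *: ((v \o shift t) (h *: (1 : R)) - v t) @[h --> 0^'] --> - y + l.
  apply: DeriveDef; first by apply/cvg_ex; exists (- y + l).
  by rewrite /derive; apply/cvg_lim.
apply/cvgrPdist_le => e e0; have e2 : 0 < e / 2 by rewrite divr_gt0.
have [dl dl0 dlP] := sigma_l _ e2.
(* [C] may be zero, hence the division by [C + 1] below. *)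
have C1 : 0 < C + 1 by rewrite ltr_wpDl.
have small (r : R) : 0 < r -> \forall k \near (0 : R)^', `|k| < r.
  by move=> r0; apply: dnbhs0_lt.
near=> h.
have h0 : h != 0 by near: h; exact: nbhs_dnbhs_neq.
have h_dl : `|h| < dl by near: h; exact: small.
have h1 : `|h| <= 1 by apply: ltW; near: h; exact: small.
have ht : `|h| <= t by apply: ltW; near: h; exact: small.
have he : `|h| < e / 2 / (C + 1) by near: h; apply: small; exact: divr_gt0.
have k0 : 0 < `|h| by rewrite normr_gt0.
have k01 : 0 < `|h| <= 1 by rewrite k0.
have gen : `| `|h|^-1 * sigma `|h| - l| < e / 2 by apply: dlP; rewrite k0.
have qk : `|h^-1 * (v (h + t) - v t) - `|h|^-1 * sigma `|h| + y| <= C * `|h|.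
  (* For negative [h] the quotient is the backward one with step [|h|]: both signs change. *)
  have [h_lt0|h_gt0|h00] := ltgtP h 0; last by rewrite h00 eqxx in h0.
    have /(quotient_estimate k0) := left_exp `|h| k01 ht.
    rewrite {1 2}(ltr0_norm h_lt0) opprK [t + h]addrC invrN mulNr -mulrN opprB.
    exact.
  have /(quotient_estimate k0) := right_exp `|h| k01.
  by rewrite {1 2}(gtr0_norm h_gt0).
have Ck : C * `|h| <= e / 2.
  rewrite ltr_pdivlMr// in he; rewrite (le_trans _ (ltW he))// mulrC.
  by rewrite ler_wpM2l// lerDl.
rewrite /= /shift/= [h *: 1]mulr1.
have -> : - y + l - h^-1 *: (v (h + t) - v t) =
  - (`|h|^-1 * sigma `|h| - l) -
  (h^-1 * (v (h + t) - v t) - `|h|^-1 * sigma `|h| + y).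
  by rewrite /GRing.scale/=; ring.
rewrite [leRHS]splitr (le_trans (ler_normB _ _))// normrN.
by rewrite lerD// ?(ltW gen)// (le_trans qk).
Unshelve. all: by end_near. Qed.

(** * The Feynman-Kac equation *)

Unset Implicit Arguments.
Set Strict Implicit.

Theorem theorem2p3 (R : realType)
  (mu : {finite_measure set (measurableTypeR R) -> \bar R})
  (mu_sym : symmetric_measure mu)
  (d : measure_display) (T : measurableType d)
  (P : R -> probability T R) (zeta : R -> T -> R)
  (zeta_levy : levy_process P zeta)
  (zeta_gen : has_generator P zeta (jump_operator mu))
  (U : R -> R) (U_cont : continuous U)
  (c1 c2 M : R) (c2_gt0 : 0 < c2) (M_gt0 : 0 < M)
  (U_ge : forall p : R, c1 <= U p)
  (U_le : forall p : R, U p <= c2 * (1 + `|p| `^ M))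
  (mu_moment :
    (\int[mu]_k ((`|k : R| `^ (2 * M))%:E) < +oo)%E)
  (g : R -> R) (g_cont : continuous g) (g_bounded : bounded_fun g) :
  pointwise_solution mu U g (feynman_kac P zeta U g).
Proof.
pose c := `|c1|; have c_ge0 : 0 <= c by exact: normr_ge0.
have cU x : - c <= U x.
  by apply: le_trans (U_ge x); rewrite lerNl /c -normrN ler_norm.
pose C0 := c2 + c.
have U_growth x : `|U x| <= C0 * growth M x.
  rewrite ler_norml; apply/andP; split; last first.
    by rewrite (le_trans (U_le x))// ler_wpM2r ?lerDl// addr_ge0// powR_ge0.
  rewrite (le_trans _ (cU x))// lerN2 (@le_trans _ _ C0)//.
    by rewrite lerDr ltW.
  by rewrite ler_peMr ?growth_ge1// addr_ge0// ltW.
have mg : measurable_fun setT g by exact: continuous_measurable_fun.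
have [B gB] : exists B : R, forall x, `|g x| <= B.
  have [B [_ BP]] := g_bounded.
  by exists (B + 1) => x; apply: (BP (B + 1)); rewrite ?ltrDl.
have [K K_ge0 X_moment] := increment_moment zeta_levy zeta_gen M_gt0 mu_moment.
split=> [t p t_gt0|p]; last exact: (feynman_kac0 zeta_levy U_cont cU mg gB).
have t_ge0 := ltW t_gt0.
set u := feynman_kac P zeta U g.
have mu_t : measurable_fun setT (u t).
  exact: (measurable_feynman_kac zeta_levy U_cont cU mg gB).
have ub x : `|u t x| <= expR (- (- c * t)) * B.
  exact: (feynman_kac_bound zeta_levy U_cont cU mg gB).
set b := expR _ * B in ub.
split.
  apply: (@integrable_le_bound _ _ _ _ _ _ (b + b)) => //.
  - by rewrite -ge0_fin_numE// fin_num_measure.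
  - apply: measurable_funB => //; apply: measurableT_comp => //.
    exact: measurable_funD.
  - by move=> k _; rewrite (le_trans (ler_normB _ _))// lerD.
(* The horizon [t + 1] leaves room for forward steps of length at most one. *)
have [C C_ge0 expand] := feynman_kac_expansion zeta_levy M_gt0 K_ge0 X_moment
  U_cont c_ge0 cU U_growth mg gB (t + 1) p.
rewrite mulNr; apply: (is_derive_expansion
  (sigma := fun h => semigroup P zeta h (u t) p - u t p) t_gt0 C_ge0).
- move=> h /andP[h0 h1]; have h01 : 0 <= h <= 1 by rewrite ltW.
  rewrite mulrA; have [|right_exp _] := expand h t h01 t_ge0; last first.
    exact: right_exp.
  by rewrite addrC lerD2l.
- move=> h /andP[h0 h1] ht; have h01 : 0 <= h <= 1 by rewrite ltW.
  (* The expansion is started at [t - h]; its second estimate refers everything to the later time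
     [t]. *)
  have th0 : 0 <= t - h by rewrite subr_ge0.
  rewrite mulrA; have := expand h (t - h) h01 th0; rewrite subrKC.
  by move=> [|_]; first by rewrite lerDl.
- move=> e e0.
  have [dl dl0 dlP] := generator_near zeta_levy zeta_gen mu_t ub e0.
  by exists dl => // h hdl; exact: dlP.
Qed.
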